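(* Let $\mathcal{K}$ be a semi-equivelar map of type $X$ on a surface with Euler characteristic $-2$. Then for every $m = 2, 3, 4, \dots$ there exists a semi-equivelar map $\mathcal{K}^m$ of type $X$ (an $m$-covering map of $\mathcal{K}$) on a surface with Euler characteristic $\chi = -2m$.
   Context: A surface is a connected closed 2-manifold (orientable or not). A map is a connected 2-dimensional cell complex on a surface (equivalently, a cellular embedding of a connected graph). All maps are polyhedral: a non-empty intersection of two distinct faces is either a vertex or an edge. Face-cycle, type: the faces containing a vertex $u$ form a cycle (the face-cycle at $u$) of the form $(F_{1,1}-\cdots-F_{1,n_1})-\cdots-(F_{k,1}-\cdots-F_{k,n_k})-F_{1,1}$, where $F_{i,\ell}$ is a $p_i$-gon for $1\le \ell\le n_i$, $1\le i\le k$, $p_r\ne p_{r+1}$ for $1\le r\le k-1$ and $p_k\ne p_1$ (if $k>1$). A map is semi-equivelar of type $[p_1^{n_1},\dots,p_k^{n_k}]$ ($p_i\ge 3$, $n_i\ge1$) if the face-cycle at every vertex has this form with the same cyclic sequence; types are considered up to cyclic rotation and reversal. Link: the vertices of the faces around $u$, other than $u$, form a cycle around $u$ (the link-cycle of $u$), bounding the disk that is the union of the faces at $u$. Cycles: a cycle in a map is contractible if it bounds a 2-disk; genus-separating if it does not bound a 2-disk but separates the surface; non-trivial if it neither bounds a 2-disk nor is genus-separating. $\ell$-covering map $\mathcal{K}^{\ell}$: let $C$ be a non-trivial cycle of length $k$ in $\mathcal{K}$ which divides the face-cycles of its vertices, i.e. for every sub-path $u-v-w$ of length two of $C$, the path $u-v-w$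 is a chord of the disk formed by the faces at $v$ (it splits the face-cycle of $v$ into faces on the two sides of $C$). Cut $\mathcal{K}$ along $C$ to get a map $\mathcal{M}$ with two boundary cycles $A(p_1,\dots,p_k)$ and $B(q_1,\dots,q_k)$, where $p_i$ and $q_i$ come from the same vertex of $C$. Take $\ell$ copies $\mathcal{M}_1,\dots,\mathcal{M}_\ell$ of $\mathcal{M}$ with boundary cycles $A_i(p^i_1,\dots,p^i_k)$ and $B_i(q^i_1,\dots,q^i_k)$, and identify $B_i$ with $A_{i+1}$ via $q^i_j\mapsto p^{i+1}_j$ for $1\le i\le \ell$ (indices $i$ modulo $\ell$). The resulting map is called an $\ell$-covering map $\mathcal{K}^\ell$ of $\mathcal{K}$. *)

(* Defs.v *)
From HB Require Import structures.
From mathcomp Require Import all_boot all_order all_algebra.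

Set Implicit Arguments.
Unset Strict Implicit.
Unset Printing Implicit Defensive.

Import GRing.Theory.
Local Open Scope ring_scope.

(* Finite maps on compact surfaces, orientable or not, possibly with boundary,
   in their flag encoding. A flag is a mutually incident (vertex, edge, face);
   t0, t1, t2 exchange its vertex, edge, face respectively, keeping the other
   two. A fixed point of t2 is a flag whose edge lies on the boundary. *)
Record cmap := CMap {
  flag :> finType;
  t0 : flag -> flag;
  t1 : flag -> flag;
  t2 : flag -> flag;
  t0K : involutive t0;
  t1K : involutive t1;
  t2K : involutive t2;
  t02C : forall x, t0 (t2 x) = t2 (t0 x);
  t0_neq : forall x, t0 x != x;
  t1_neq : forall x, t1 x != x;
  t02_neq : forall x, t0 (t2 x) != x
}.

Definition adj_rel (M : cmap) : rel M :=
  [rel x y | [|| y == t0 x, y == t1 x | y == t2 x]].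

(* Vertices, edges and faces are encoded as the sets of flags containing them;
   a vertex, an edge and a face are incident when these sets meet. *)
Definition vertex_of (M : cmap) (x : M) : {set M} :=
  [set y | connect [rel u w | (w == t1 u) || (w == t2 u)] x y].
Definition edge_of (M : cmap) (x : M) : {set M} :=
  [set y | connect [rel u w | (w == t0 u) || (w == t2 u)] x y].
Definition face_of (M : cmap) (x : M) : {set M} :=
  [set y | connect [rel u w | (w == t0 u) || (w == t1 u)] x y].
Definition component_of (M : cmap) (x : M) : {set M} :=
  [set y | connect (@adj_rel M) x y].

Definition vertices (M : cmap) : {set {set M}} := [set vertex_of x | x : M].
Definition edges (M : cmap) : {set {set M}} := [set edge_of x | x : M].
Definition faces (M : cmap) : {set {set M}} := [set face_of x | x : M].
Definition components (M : cmap) : {set {set M}} :=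
  [set component_of x | x : M].

Definition vertices_at (M : cmap) (A : {set M}) : {set {set M}} :=
  [set v in vertices M | v :&: A != set0].
Definition edges_at (M : cmap) (A : {set M}) : {set {set M}} :=
  [set e in edges M | e :&: A != set0].
Definition faces_at (M : cmap) (A : {set M}) : {set {set M}} :=
  [set f in faces M | f :&: A != set0].

Definition euler_on (M : cmap) (A : {set M}) : int :=
  #|vertices_at A|%:Z - #|edges_at A|%:Z + #|faces_at A|%:Z.
Definition euler (M : cmap) : int :=
  #|vertices M|%:Z - #|edges M|%:Z + #|faces M|%:Z.

Definition boundaryless (M : cmap) : Prop := forall x : M, t2 x != x.
Definition connected (M : cmap) : Prop := #|components M| = 1%N.

Definition polyhedral (M : cmap) : Prop :=
  (* the boundary walk of a face visits each vertex once, so that closed faces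
     are polygonal disks *)
  (forall x y : M, y \in vertex_of x -> y \in face_of x -> y = x \/ y = t1 x)
  /\
  (forall f g : {set M}, f \in faces M -> g \in faces M -> f != g ->
     vertices_at f :&: vertices_at g != set0 ->
     (exists2 v, v \in vertices M &
        vertices_at f :&: vertices_at g = [set v] /\
        edges_at f :&: edges_at g = set0) \/
     (exists2 e, e \in edges M &
        vertices_at f :&: vertices_at g = vertices_at e /\
        edges_at f :&: edges_at g = [set e])).

(* Rotation about the vertex of a flag, to the next face around that vertex. *)
Definition turn (M : cmap) (x : M) : M := t2 (t1 x).

(* The face-cycle at the vertex of x; the choice of x among the flags at the
   vertex amounts to the choice of a starting face and a direction. *)
Definition face_cycle (M : cmap) (x : M) : seq {set M} :=
  [seq face_of y | y <- orbit (@turn M) x].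

Definition face_length (M : cmap) (f : {set M}) : nat := #|vertices_at f|.

(* [:: (p_1, n_1); ...; (p_k, n_k)] stands for [p_1^{n_1}, ..., p_k^{n_k}]. *)
Definition map_type := seq (nat * nat).

Definition wf_map_type (X : map_type) : bool :=
  [&& X != [::], all (fun a => (2 < a.1)%N && (0 < a.2)%N) X
    & (size X == 1%N) || cycle (fun a b : nat * nat => a.1 != b.1) X].

Definition type_word (X : map_type) : seq nat :=
  flatten [seq nseq a.2 a.1 | a <- X].

Definition semi_equivelar (X : map_type) (K : cmap) : Prop :=
  [/\ boundaryless K, connected K, polyhedral K, wf_map_type X
    & forall v, v \in vertices K ->
        exists2 x, x \in v &
          [seq face_length f | f <- face_cycle x] = type_word X].

(* A cycle v_1, ..., v_k of the 1-skeleton is given by flags x_1, ..., x_k with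
   x_i at v_i on the edge v_i v_(i+1); the faces of the x_i are irrelevant. *)
Definition is_cycle (M : cmap) (c : seq M) : Prop :=
  [/\ (2 < size c)%N, uniq [seq vertex_of x | x <- c]
    & cycle (fun x y => vertex_of (t0 x) == vertex_of y) c].

Definition edge_flags (M : cmap) (c : seq M) : {set M} :=
  [set y | has (fun x => y \in edge_of x) c].

Section Cut.
Variables (M : cmap) (c : seq M).

Definition cut_t2 (x : M) : M := if x \in edge_flags c then x else t2 x.

Lemma edge_flags_t0 x : (t0 x \in edge_flags c) = (x \in edge_flags c).
Proof.
rewrite !inE; apply: eq_has => z; rewrite !inE.
by apply/idP/idP => /connect_trans; apply; apply: connect1;
   rewrite /= ?t0K eqxx.
Qed.

Lemma edge_flags_t2 x : (t2 x \in edge_flags c) = (x \in edge_flags c).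
Proof.
rewrite !inE; apply: eq_has => z; rewrite !inE.
by apply/idP/idP => /connect_trans; apply; apply: connect1;
   rewrite /= ?t2K eqxx orbT.
Qed.

Lemma cut_t2K : involutive cut_t2.
Proof.
move=> x; rewrite /cut_t2; case xc: (x \in _); first by rewrite xc.
by rewrite edge_flags_t2 xc t2K.
Qed.

Lemma cut_t02C x : t0 (cut_t2 x) = cut_t2 (t0 x).
Proof. by rewrite /cut_t2 edge_flags_t0; case: ifP => // _; apply: t02C. Qed.

Lemma cut_t02_neq x : t0 (cut_t2 x) != x.
Proof.
by rewrite /cut_t2; case: ifP => _; [apply: t0_neq | apply: t02_neq].
Qed.

(* M cut along c: the faces of M are no longer glued across the edges of c. *)
Definition cut : cmap :=
  @CMap M (@t0 M) (@t1 M) cut_t2 (@t0K M) (@t1K M) cut_t2K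
        cut_t02C (@t0_neq M) (@t1_neq M) cut_t02_neq.

End Cut.

Definition separates (K : cmap) (c : seq K) : Prop :=
  (1 < #|components (cut c)|)%N.

(* c bounds a disk D: D is a piece of the surface cut along c, it lies on
   exactly one side of each edge of c, and it is a disk, i.e. its Euler
   characteristic is 1 (a compact connected surface with nonempty boundary is a
   disk exactly when its Euler characteristic is 1). *)
Definition bounds_disk (K : cmap) (c : seq K) : Prop :=
  exists2 D : {set cut c}, D \in components (cut c) &
    (forall x : K, x \in c -> (x \in D) != (@t2 K x \in D)) /\ euler_on D = 1.

Definition genus_separating (K : cmap) (c : seq K) : Prop :=
  ~ bounds_disk c /\ separates c.

Definition nontrivial_cycle (K : cmap) (c : seq K) : Prop :=
  ~ bounds_disk c /\ ~ genus_separating c.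

(* For a sub-path u-v-w of c with edges uv and vw carried by x and next c x: the
   face-cycle at v, read from one side of vw, splits at the edge uv. *)
Definition divides_face_cycles (K : cmap) (c : seq K) : Prop :=
  forall x, x \in c ->
    exists z z' : K, exists s s' : seq K,
      [/\ z \in vertex_of (next c x), z \in edge_of (next c x),
          z' \in edge_of x & orbit (@turn K) z = (z :: s) ++ (z' :: s')].

Definition boundary_cycle (M : cmap) (a : seq M) : Prop :=
  is_cycle a /\ forall x, x \in a -> t2 x = x.

(* The boundary of the cut map consists of two disjoint cycles A = a and B = b,
   whose i-th vertices both come from the i-th vertex of c. The flags of cut c
   are those of K, so @vertex_of K x is the vertex of K from which the vertex
   @vertex_of (cut c) x of the cut map comes. *)
Definition cut_boundaries (K : cmap) (c : seq K) (a b : seq (cut c)) : Prop :=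
  [/\ boundary_cycle a, boundary_cycle b,
      uniq [seq @vertex_of (cut c) x | x <- a ++ b],
      [set x : cut c | @t2 (cut c) x == x] = @edge_flags (cut c) (a ++ b)
    & [seq @vertex_of K x | x <- a] = [seq @vertex_of K x | x <- c] /\
      [seq @vertex_of K x | x <- b] = [seq @vertex_of K x | x <- c]].

(* L is obtained from l copies of M by gluing the cycle b of copy i to the cycle
   a of copy i + 1 (mod l), the j-th edge of b being glued to the j-th edge of a
   with matching origins. The gluing of the flags t0 x and t0 y at the other
   ends of these edges follows, as t0 and t2 commute in L. *)
Definition cyclic_gluing (l : nat) (M : cmap) (a b : seq M) (L : cmap) : Prop :=
  exists phi : M * 'I_l -> L,
    [/\ bijective phi,
        forall x i, t0 (phi (x, i)) = phi (t0 x, i),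
        forall x i, t1 (phi (x, i)) = phi (t1 x, i),
        forall x i, t2 x != x -> t2 (phi (x, i)) = phi (t2 x, i)
      & forall x y i, (x, y) \in zip b a ->
          t2 (phi (x, i)) = phi (y, ordS i)].

Definition covering_map (l : nat) (K L : cmap) : Prop :=
  exists c : seq K,
    [/\ is_cycle c, nontrivial_cycle c, divides_face_cycles c
      & exists a b : seq (cut c),
          cut_boundaries a b /\ cyclic_gluing l a b L].

(* Main.v *)
(* The [m]-fold cyclic covering is unbranched, and unbranched coverings of
   polyhedral maps are polyhedral of the same type, with proportional Euler
   characteristic; the point is to find a two-sided non-separating cycle in the
   1-skeleton. Colour the flags around each vertex by local orientation and let
   [w] be the mod 2 cochain of the orientation-reversing edges. As E - F - V = 2,
   counting dimensions gives a mod 2 cocycle [h] that is neither a coboundary nor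
   [w] plus a coboundary. A simple cycle with [w = 0] and [h = 1] is two-sided
   since [w = 0], and does not separate since the cocycle [h] does not vanish on
   it.

   Such a simple cycle exists: otherwise, all cycles with [w = 0] have [h = 0], and
   adding a multiple of [w] to [h] we may start from a cycle with [w = 1] and
   [h = 0]. Grow it by ears cut out of face boundaries, keeping the invariant that
   any two distinct vertices are joined by simple paths of both [w]-parities whose
   [h]-values are given by a potential: closing an ear by a path of the right
   parity shows that the potential extends. At the end [h] is a coboundary. *)
Require Import Defs.
From HB Require Import structures.
From mathcomp Require Import all_boot all_order all_algebra.
From mathcomp Require Import zify ring.
From Stdlib Require Import Classical.

Set Implicit Arguments.
Unset Strict Implicit.
Unset Printing Implicit Defensive.

Import GRing.Theory.
Local Open Scope ring_scope.

(** * Orbits of two involutions and gains of paths *)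

(** The obstacle is simplicity. A closed walk with [w = 0] and [h = 1] may break into two simple
    cycles with [w = 1], one with [h = 0] and one with [h = 1], and a one-sided cycle cannot be cut
    into two boundary cycles. Hence the parity has to be controlled along simple paths, and [h] has
    to differ from [w], not only from 0, modulo coboundaries. The value -2 enters as E - F > V + 1:
    the left side bounds the dimension of the cocycles from below, the right side that of the
    coboundaries together with [w] from above. The covering is not assembled from copies of the cut
    map: its flags are pairs of a flag of [K] and a sheet number mod [m], and crossing the cycle
    moves to a neighbouring sheet. Two-sidedness makes the crossings met while turning about a
    vertex cancel, so that a full turn returns to its sheet. *)

Section Orbits.
Variables (T : finType) (s t : T -> T).
Hypotheses (sK : involutive s) (tK : involutive t).

Definition orb (x : T) : {set T} :=
  [set y | connect [rel u w | (w == s u) || (w == t u)] x y].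

Lemma mem_orb x : x \in orb x.
Proof. by rewrite inE connect0. Qed.

Lemma orb_ind x (P : T -> Prop) : P x ->
  (forall y, P y -> P (s y)) -> (forall y, P y -> P (t y)) ->
  forall y, y \in orb x -> P y.
Proof.
move=> Px Ps Pt y; rewrite inE => /connectP[p].
elim: p x Px => [|z p IH] x Px /=; first by move=> _ ->.
by case/andP=> /orP[]/eqP-> pz yE; apply: IH pz yE; auto.
Qed.

Lemma orb_eq x y : y \in orb x -> orb y = orb x.
Proof.
have sym : connect_sym [rel u w | (w == s u) || (w == t u)].
  apply: sym_connect_sym => u v.
  by rewrite /= ![v == _]eq_sym (can2_eq sK sK) (can2_eq tK tK).
rewrite inE => xy; apply/setP => z; rewrite !inE.
by apply/idP/idP; apply: connect_trans; rewrite // sym.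
Qed.

Lemma orb_s x : orb (s x) = orb x.
Proof. by apply: orb_eq; rewrite inE connect1 //= eqxx. Qed.

Lemma orb_t x : orb (t x) = orb x.
Proof. by apply: orb_eq; rewrite inE connect1 //= eqxx orbT. Qed.

Lemma mem_orbE x y : (y \in orb x) = (orb y == orb x).
Proof. by apply/idP/eqP => [/orb_eq//|<-]; apply: mem_orb. Qed.

Lemma mem_orb_sym x y : (y \in orb x) = (x \in orb y).
Proof. by rewrite !mem_orbE eq_sym. Qed.

Lemma mem_orb_s x y : (s y \in orb x) = (y \in orb x).
Proof. by rewrite !mem_orbE orb_s. Qed.

Lemma mem_orb_t x y : (t y \in orb x) = (y \in orb x).
Proof. by rewrite !mem_orbE orb_t. Qed.

Lemma dihedral_rot_inj : injective (t \o s).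
Proof. by apply: inj_comp; apply: can_inj; eassumption. Qed.

Lemma iter_rot_orb k x : iter k (t \o s) x \in orb x.
Proof. by elim: k => [|k IH]; rewrite ?mem_orb //= mem_orb_t mem_orb_s. Qed.

Lemma orbit_rot_sub x y : y \in orbit (t \o s) x -> y \in orb x.
Proof.
by rewrite -fconnect_orbit => /iter_findex <-; apply: iter_rot_orb.
Qed.

Lemma orb_rot x y : y \in orb x ->
  (y \in orbit (t \o s) x) || (s y \in orbit (t \o s) x).
Proof.
have closedr z : z \in orbit (t \o s) x -> t (s z) \in orbit (t \o s) x.
  rewrite -!fconnect_orbit => xz.
  exact: connect_trans xz (fconnect1 (t \o s) z).
have closedl z : z \in orbit (t \o s) x -> s (t z) \in orbit (t \o s) x.
  rewrite -!fconnect_orbit (fconnect_sym dihedral_rot_inj) => xz.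
  rewrite (fconnect_sym dihedral_rot_inj); apply: connect_trans xz.
  by have := fconnect1 (t \o s) (s (t z)); rewrite /= sK tK.
apply: (orb_ind (P := fun y => _ || _)).
- by rewrite in_orbit.
- by move=> z; rewrite sK orbC.
- move=> z /orP[] h; last by rewrite -{1}[z]sK closedr.
  by rewrite closedl ?orbT.
Qed.

Section FixedPointFree.
Hypotheses (s_neq : forall x, s x != x) (t_neq : forall x, t x != x).

(** Conjugation shortens the equation by two turns, from [x] to [t (s x)]; what remains in the end
    is a fixed point of [s] or of [t]. So rotations never agree with reflections, which makes the
    colouring possible. *)
Lemma iter_rot_neq_s k x : iter k (t \o s) x != s x.
Proof.
elim/ltn_ind: k x => -[|[|k]] IH x; first by rewrite eq_sym s_neq.
  by rewrite /= t_neq.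
rewrite iterS iterSr; apply/negP => /eqP/(congr1 (s \o t)).
rewrite /= tK sK; apply/eqP; apply: IH; lia.
Qed.

Lemma iter_rot_neq_t k x : iter k (t \o s) x != t x.
Proof.
case: k => [|k]; first by rewrite eq_sym t_neq.
rewrite iterS /=; apply/negP => /eqP/(can_inj tK)/(canRL sK).
by apply/eqP/iter_rot_neq_s.
Qed.

Lemma notin_orbit_s x : s x \notin orbit (t \o s) x.
Proof.
apply/negP; rewrite -fconnect_orbit => /iter_findex/eqP; apply/negP.
exact: iter_rot_neq_s.
Qed.

(* Locally at an orbit, [s] and [t] are reflections and [t \o s] a rotation;
   the colour tells the two orientations of a flag apart. *)
Definition colour (x : T) : bool :=
  x \in orbit (t \o s) (odflt x [pick y in orb x]).

Lemma colour_root x : odflt x [pick y in orb x] \in orb x.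
Proof. by case: pickP => //= /(_ x); rewrite mem_orb. Qed.

Lemma colour_root_orb x y : y \in orb x ->
  odflt y [pick z in orb y] = odflt x [pick z in orb x].
Proof.
by move=> yx; rewrite (orb_eq yx); case: pickP => //= /(_ x); rewrite mem_orb.
Qed.

Lemma colour_s x : colour (s x) = ~~ colour x.
Proof.
rewrite /colour (@colour_root_orb x) ?mem_orb_s ?mem_orb //.
set r := odflt _ _; have xr : x \in orb r by rewrite mem_orb_sym colour_root.
have /orP[h|h] := orb_rot xr; rewrite h.
  apply/negP => h'; have /negP[] := notin_orbit_s x; move: h h'.
  rewrite -!fconnect_orbit (fconnect_sym dihedral_rot_inj); exact: connect_trans.
apply/esym/negP => h'; have /negP[] := notin_orbit_s x; move: h' h.
rewrite -!fconnect_orbit (fconnect_sym dihedral_rot_inj); exact: connect_trans.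
Qed.

Lemma colour_rot x : colour (t (s x)) = colour x.
Proof.
rewrite /colour (@colour_root_orb x) ?mem_orb_t ?mem_orb_s ?mem_orb //.
set r := odflt _ _; rewrite -!fconnect_orbit.
by rewrite -(same_connect1r (fconnect_sym dihedral_rot_inj) (y := t (s x)) (x := x)) //=.
Qed.

Lemma colour_t x : colour (t x) = ~~ colour x.
Proof. by rewrite -{1}[x]sK colour_rot colour_s. Qed.

Lemma colour_orbit x y : y \in orb x -> colour y = colour x ->
  y \in orbit (t \o s) x.
Proof.
move=> yx cyx; have /orP[//|] := orb_rot yx.
rewrite -fconnect_orbit => /iter_findex syE.
have : colour (s y) = colour x.
  by rewrite -syE; elim: (findex _ _ _) => //= n IH; rewrite colour_rot.
by rewrite colour_s cyx; case: (colour x).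
Qed.

Section SignedSums.
Variable R : zmodType.

Lemma sum_colour_swap (F : T -> R) x b :
  \sum_(z in orb x | colour z == b) F z
  = \sum_(z in orb x | colour z == ~~ b) F (s z).
Proof.
rewrite (reindex_onto s s) => [|z _]; last exact: sK.
apply: eq_bigl => z; rewrite sK eqxx andbT mem_orb_s colour_s.
by case: colour b => -[].
Qed.

End SignedSums.

End FixedPointFree.
End Orbits.

Section GainSequence.
Variables (V : finType) (e : rel V).

Fixpoint gain (g : V -> V -> bool) (x : V) (p : seq V) : bool :=
  if p is y :: q then g x y (+) gain g y q else false.

Lemma gain_cat g x p q : gain g x (p ++ q) = gain g x p (+) gain g (last x p) q.
Proof. by elim: p x => //= y p IH x; rewrite IH addbA. Qed.

Lemma gain_rcons g x p y : gain g x (rcons p y) = gain g x p (+) g (last x p) y.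
Proof. by rewrite -cats1 gain_cat /= addbF. Qed.

Lemma gain_rev g x p : (forall u v, g u v = g v u) ->
  gain g (last x p) (rev (belast x p)) = gain g x p.
Proof.
move=> gC; elim: p x => //= y p IH x.
rewrite rev_cons gain_rcons IH gC addbC; congr (_ (+) _).
by case: p {IH} => //= z p; rewrite rev_cons last_rcons.
Qed.

Hypothesis eC : symmetric e.
Variables w h : V -> V -> bool.
Hypotheses (wC : forall u v, w u v = w v u) (hC : forall u v, h u v = h v u).

(** The bound [A] on the support is what allows concatenation: two simple paths whose supports meet
    only at the junction form a simple path. *)
Definition joined (A : {pred V}) (a b : V) (r r' : bool) :=
  exists p, [/\ path e a p, last a p = b, uniq (a :: p), {subset a :: p <= A}
             & gain w a p = r /\ gain h a p = r'].

Lemma joined_sub (A B : {pred V}) a b r r' : {subset A <= B} ->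
  joined A a b r r' -> joined B a b r r'.
Proof.
by move=> AB [p [pp lp up sp gp]]; exists p; split=> // z /sp/AB.
Qed.

Lemma joined_sym A a b r r' : joined A a b r r' -> joined A b a r r'.
Proof.
case=> p [pp <- up sp [gw gh]]; exists (rev (belast a p)).
have perm_p : perm_eq (last a p :: rev (belast a p)) (a :: p).
  by rewrite -rev_rcons -lastI perm_rev.
split.
- by rewrite rev_path (eq_path (e' := e)) // => u v; apply: eC.
- by case: p {pp up sp gw gh perm_p} => //= z p; rewrite rev_cons last_rcons.
- by rewrite (perm_uniq perm_p).
- by move=> z; rewrite (perm_mem perm_p); apply: sp.
- by rewrite !gain_rev.
Qed.

Lemma joined_trans A B a b c r1 r1' r2 r2' :
  joined A a b r1 r1' -> joined B b c r2 r2' ->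
  (forall z, z \in A -> z \in B -> z = b) ->
  joined [predU A & B] a c (r1 (+) r2) (r1' (+) r2').
Proof.
case=> p [pp lp up sp [gw gh]] [q [pq lq uq sq [gw' gh']]] AB.
exists (p ++ q); split.
- by rewrite cat_path pp lp pq.
- by rewrite last_cat lp.
- move: uq; rewrite cons_uniq => /andP[bq uq'].
  rewrite -cat_cons cat_uniq up uq' andbT /=.
  apply/hasPn => z zq; apply: contra bq => zp.
  by rewrite -(AB z) // ?sp // sq // inE zq orbT.
- move=> z; rewrite -cat_cons mem_cat inE.
  by case/orP=> [/sp zA|zq]; apply/orP; [left | right; apply: sq; rewrite inE zq orbT].
- by rewrite !gain_cat lp gw gw' gh gh'.
Qed.

Lemma joined_path A a p : path e a p -> uniq (a :: p) -> {subset a :: p <= A} ->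
  joined A a (last a p) (gain w a p) (gain h a p).
Proof. by exists p. Qed.

Lemma joined_refl (A : {pred V}) a : a \in A -> joined A a a false false.
Proof. by exists [::]; split=> // z; rewrite inE => /eqP->. Qed.

End GainSequence.

(** * Ears and balanced cycles in graphs *)

Section Ears.
Variables (V : finType) (e : rel V).
Hypotheses (eC : symmetric e) (e_irr : irreflexive e).

(** The interior [q] is non-empty, so that each ear adds vertices; chords are left to the end, when
    [S] is everything. *)
Definition ear (S : {set V}) (u : V) (q : seq V) (b : V) :=
  [/\ path e u (rcons q b), uniq q, q != [::],
      u \in S /\ b \in S & forall z, z \in q -> z \notin S].

(** Stands in for 2-connectivity. The condition that vertices of [S] have neighbours in [S] holds
    for the sets grown from a cycle; it provides a face corner with one edge staying in [S] and one
    leaving it. *)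
Definition has_ears := forall S : {set V}, S != set0 -> S != setT ->
  (forall u, u \in S -> exists2 v, v \in S & e u v) ->
  exists u q b, u != b /\ ear S u q b.

Definition simple_cycle (x : V) (p : seq V) :=
  [/\ path e x (rcons p x), uniq (x :: p) & (1 < size p)%N].

Variables w h : V -> V -> bool.
Hypotheses (wC : forall u v, w u v = w v u) (hC : forall u v, h u v = h v u).

Definition spread (S : {set V}) (f : V -> bool) :=
  forall a b r, a \in S -> b \in S -> a != b ->
  joined e w h (mem S) a b r (f a (+) f b).

(** Continues [f] from [u] along the ear by the [h]-gain; [take (index z q).+1 q] is the part of the
    ear up to and including [z]. *)
Definition ear_potential (f : V -> bool) u (q : seq V) z :=
  if z \in q then f u (+) gain h u (take (index z q).+1 q) else f z.

Lemma ear_potentialE f u q1 y q2 : uniq (q1 ++ y :: q2) ->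
  ear_potential f u (q1 ++ y :: q2) y = f u (+) gain h u (rcons q1 y).
Proof.
rewrite cat_uniq /= => /and3P[_ /norP[yq1 _] _].
rewrite /ear_potential mem_cat mem_head orbT index_cat (negbTE yq1) /= eqxx.
by rewrite addn0 take_cat ltnNge leqnSn subSnn /= take0 cats1.
Qed.

Lemma ear_potential_out f u q z : z \notin q -> ear_potential f u q z = f z.
Proof. by rewrite /ear_potential => /negbTE->. Qed.

Lemma split2 (q : seq V) y z : y \in q -> z \in q -> y != z ->
  (exists q1 q2 q3, q = q1 ++ y :: q2 ++ z :: q3) \/
  (exists q1 q2 q3, q = q1 ++ z :: q2 ++ y :: q3).
Proof.
case/splitPr=> q1 q2; rewrite mem_cat inE eq_sym => + /negbTE yz.
rewrite yz /= => /orP[]/splitPr[q3 q4]; [right | left].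
  by exists q3, q4, q2; rewrite -catA.
by exists q1, q3, q4.
Qed.

(* Once [S] is spread, a detour through [S] realises every [w]-gain, so the
   cycle hypothesis fixes the [h]-gain of each ear. *)
Hypothesis cycle_gain : forall x p, simple_cycle x p ->
  gain w x (rcons p x) = false -> gain h x (rcons p x) = false.

Lemma spread_ear_gain S f u q b : spread S f -> u != b -> ear S u q b ->
  gain h u (rcons q b) = f u (+) f b.
Proof.
move=> Sf neq_ub [pq uq q0 [uS bS] qS].
have := Sf b u (gain w u (rcons q b)) bS uS; rewrite eq_sym => /(_ neq_ub).
case=> p [pp lp up sp [gw gh]].
have cyc : simple_cycle b (p ++ q).
  split.
  - by rewrite rcons_cat cat_path pp lp.
  - rewrite -cat_cons cat_uniq up uq andbT /=.
    by apply/hasPn => z /qS; apply: contra => /sp.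
  - case: p {pp up sp gw gh} lp => [/= bu|z p _]; first by rewrite bu eqxx in neq_ub.
    by rewrite size_cat /=; case: (q) q0 => //= *; lia.
have := cycle_gain cyc; rewrite rcons_cat !gain_cat lp gw gh.
by case: (gain w _ _) (gain h _ _) (f u) (f b) => [] [] [] [] //= ->.
Qed.

(** A new vertex leaves the ear through one end and goes on inside [S], where both parities are
    available. Two new vertices leave through opposite ends, away from each other, and are joined
    across [S]. The gain of the whole ear makes both exits agree with the potential. *)
Lemma spread_ear S f u q b : spread S f -> u != b -> ear S u q b ->
  spread (S :|: [set z in q]) (ear_potential f u q).
Proof.
move=> Sf neq_ub qE; have gq := spread_ear_gain Sf neq_ub qE.
case: qE => pq uq q0 [uS bS] qS; set S' := _ :|: _; set f' := ear_potential f u q.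
have f'S z : z \in S -> f' z = f z.
  by move=> zS; rewrite /f' ear_potential_out //; apply: contraL zS => /qS.
have toS (A : {pred V}) c : {subset A <= q} -> c \in S ->
    {subset [predU [predU A & pred1 c] & mem S] <= S'}.
  move=> Aq cS z; rewrite !inE => /orP[/orP[/Aq->|/eqP->]|->] //;
    by rewrite ?orbT ?cS.
have left q1 y q2 : q = q1 ++ y :: q2 ->
    exists r, joined e w h [predU mem (rcons q1 y) & pred1 u] y u r (f' y (+) f u).
  move=> qE; exists (gain w u (rcons q1 y)); apply: joined_sym => //.
  move: (pq) (uq); rewrite qE -cat_rcons rcons_cat cat_path => /andP[p1 _].
  rewrite cat_uniq => /andP[u1 _].
  have := @joined_path V e w h [predU mem (rcons q1 y) & pred1 u] u (rcons q1 y) p1.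
  rewrite last_rcons.
  rewrite /f' qE ear_potentialE -?qE // addbAC addbb addFb; apply.
    rewrite cons_uniq u1 andbT; apply/negP => u1q; have := qS u.
    by rewrite uS qE -cat_rcons mem_cat u1q => /(_ isT).
  by move=> z; rewrite !inE orbC.
have right q1 y q2 : q = q1 ++ y :: q2 ->
    exists r, joined e w h [predU mem (y :: q2) & pred1 b] y b r (f' y (+) f b).
  move=> qE; exists (gain w y (rcons q2 b)).
  move: (pq) (uq); rewrite qE -cat_rcons rcons_cat cat_path => /andP[p1 p2].
  rewrite cat_rcons cat_uniq => /and3P[_ _ u2].
  rewrite last_rcons in p2.
  have := @joined_path V e w h [predU mem (y :: q2) & pred1 b] y (rcons q2 b) p2.
  rewrite last_rcons.
  have -> : gain h y (rcons q2 b) = f' y (+) f b.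
    rewrite /f' qE ear_potentialE -?qE //.
    move: gq; rewrite qE -cat_rcons rcons_cat gain_cat last_rcons.
    by case: (gain h y _) (gain h u _) (f u) (f b) => [] [] [] [].
  apply.
    rewrite -rcons_cons rcons_uniq u2 andbT; apply/negP => u1q.
    by have := qS b; rewrite bS qE mem_cat u1q orbT => /(_ isT).
  by move=> z; rewrite -rcons_cons mem_rcons !inE; do !case: (_ == _); do ?case: (_ \in _).
have one y s r : y \in q -> s \in S -> joined e w h (mem S') y s r (f' y (+) f' s).
  move=> yq sS; rewrite (f'S s) //.
  have [q1 [q2 qE]] : exists q1 q2, q = q1 ++ y :: q2.
    by case/splitPr: yq => q1 q2; exists q1, q2.
  have viaS (A : {pred V}) t r0 : t \in S -> t != s -> {subset A <= q} ->
      joined e w h [predU A & pred1 t] y t r0 (f' y (+) f t) ->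
      joined e w h (mem S') y s r (f' y (+) f s).
    move=> tS ts Aq J; have J' := Sf t s (r0 (+) r) tS sS ts.
    have := joined_trans J J'; rewrite !addbA addbb addFb.
    rewrite -[_ (+) f t (+) f t]addbA addbb addbF => J2.
    apply: (joined_sub (toS _ _ Aq tS)); apply: J2 => z.
    by rewrite inE => /orP[/Aq/qS/negP|/eqP].
  (* The exit must differ from [s], since paths inside [S] are provided only between distinct
     vertices. *)
  have [us|us] := eqVneq u s.
    have [r0 J] := right _ _ _ qE; apply: viaS J => //.
      by rewrite -us eq_sym.
    by move=> z; rewrite qE mem_cat => ->; rewrite orbT.
  have [r0 J] := left _ _ _ qE; apply: viaS J => //.
  by move=> z; rewrite qE -cat_rcons mem_cat => ->.
have two y z r q1 q2 q3 : q = q1 ++ y :: q2 ++ z :: q3 ->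
    joined e w h (mem S') y z r (f' y (+) f' z).
  move=> qE; have [r1 J1] := left _ _ _ qE.
  have [r2 J2] : exists r2, joined e w h [predU mem (z :: q3) & pred1 b] z b r2
      (f' z (+) f b).
    by apply: (right (q1 ++ y :: q2)); rewrite qE -catA.
  (* This parity cancels those of the two pieces of the ear and leaves [r]. *)
  have J := Sf u b (r1 (+) r (+) r2) uS bS neq_ub.
  have q1S x : x \in rcons q1 y -> x \notin S.
    by move=> xq; apply: qS; rewrite qE -cat_rcons mem_cat xq.
  have q3S x : x \in z :: q3 -> x \notin S.
    move=> xq; apply: qS; rewrite qE -cat_cons catA mem_cat xq.
    by rewrite orbT.
  have := joined_trans (joined_trans J1 J _) (joined_sym eC wC hC J2).
  have -> : r1 (+) (r1 (+) r (+) r2) (+) r2 = r by case: (r1) (r) (r2) => [] [] [].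
  have -> : f' y (+) f u (+) (f u (+) f b) (+) (f' z (+) f b) = f' y (+) f' z.
    by case: (f' y) (f' z) (f u) (f b) => [] [] [] [].
  move=> J3; apply: joined_sub (J3 _ _).
  - move=> x; rewrite !inE !mem_rcons !inE qE !(mem_cat, inE).
    have [->|_] := eqVneq x u; first by rewrite uS.
    have [->|_] := eqVneq x b; first by rewrite bS.
    by rewrite !orbF; do !case: (x \in _); do !case: (_ == _); do ?case: (_ \in _).
  - move=> x; rewrite inE => /orP[/q1S/negP|/eqP] //.
  - move=> x; rewrite inE => /orP[/orP[xq1|/eqP->]|xS].
    + rewrite inE => /orP[xq3|/eqP //].
      move: (uq); rewrite qE -cat_rcons cat_uniq => /and3P[_ /hasPn].
      by move=> /(_ x); rewrite mem_cat xq3 orbT => /(_ isT); rewrite /= xq1.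
    + rewrite inE => /orP[/q3S/negP|/eqP] //.
    + by rewrite inE => /orP[/q3S/negP|/eqP].
move=> a c r; rewrite !inE => aS' cS' ac.
have [aS|aS] := boolP (a \in S); have [cS|cS] := boolP (c \in S);
  move: aS' cS'; rewrite ?aS ?cS ?(negbTE aS) ?(negbTE cS) /=.
- move=> _ _; rewrite !f'S //; apply: joined_sub (Sf _ _ _ aS cS ac).
  by move=> z; rewrite !inE => ->.
- by move=> _ cq; rewrite addbC; apply: joined_sym => //; apply: one.
- by move=> aq _; apply: one.
- move=> aq cq; case: (split2 aq cq ac) => -[q1 [q2 [q3 qE]]].
    exact: two qE.
  by rewrite addbC; apply: joined_sym => //; apply: two qE.
Qed.

(** Two vertices cut the cycle into two arcs. As the total gains are [w = 1] and [h = 0], the arcs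
    have different [w]-gains and equal [h]-gains. *)
Lemma spread_cycle x q : simple_cycle x q ->
  gain w x (rcons q x) = true -> gain h x (rcons q x) = false ->
  spread [set z in x :: q] (ear_potential xpred0 x q).
Proof.
case=> pq; rewrite cons_uniq => /andP[xq uq] sq gw gh; set f' := ear_potential _ x q.
set S' := [set z in _].
have f'x : f' x = false by rewrite /f' ear_potential_out.
have seg c s d : subseq (rcons (c :: s) d) (rcons (x :: q) x) ->
    path e c (rcons s d) -> uniq (c :: s) -> d \notin c :: s ->
    joined e w h (mem S') c d (gain w c (rcons s d)) (gain h c (rcons s d)).
  move=> sub ps us ds; rewrite -{1}[d](last_rcons c s); apply: joined_path => //.
    by rewrite -rcons_cons rcons_uniq ds us.
  move=> z; rewrite -rcons_cons => /(mem_subseq sub).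
  by rewrite mem_rcons !inE; do !case: (_ == _); do ?case: (_ \in _).
have one q1 y q2 r : q = q1 ++ y :: q2 -> joined e w h (mem S') x y r (f' x (+) f' y).
  move=> qE; rewrite f'x addFb /f' qE ear_potentialE -?qE // addFb.
  move: (pq) (uq) gw gh; rewrite qE -cat_rcons rcons_cat cat_path => /andP[p1 p2].
  rewrite cat_rcons cat_uniq => /and3P[u1 /norP[yq1 _] u2].
  rewrite !gain_cat; rewrite last_rcons in p2 *.
  move: xq; rewrite qE mem_cat inE !negb_or => /and3P[xq1 xy xq2] gw gh.
  have Jl : joined e w h (mem S') x y (gain w x (rcons q1 y)) (gain h x (rcons q1 y)).
    apply: seg => //.
    - rewrite rcons_cons qE -cat_rcons -cat_cons rcons_cat; exact: prefix_subseq.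
    - by rewrite /= xq1.
    - by rewrite inE eq_sym negb_or xy.
  have Jr : joined e w h (mem S') x y (gain w y (rcons q2 x)) (gain h y (rcons q2 x)).
    apply: joined_sym => //; apply: seg => //.
    - rewrite qE -[x :: _]cat1s catA rcons_cat; exact: suffix_subseq.
    - by rewrite inE negb_or xy.
  move: Jl Jr gw gh; case: (gain w x _) (gain w y _) (gain h x _) (gain h y _) r;
    by move=> [] [] [] [].
have two q1 y q2 z q3 r : q = q1 ++ y :: q2 ++ z :: q3 ->
    joined e w h (mem S') y z r (f' y (+) f' z).
  move=> qE; have qE' : q = (q1 ++ y :: q2) ++ z :: q3 by rewrite qE -catA.
  rewrite /f' {1}qE ear_potentialE -?qE // qE' ear_potentialE -?qE' // !addFb.
  move: (pq) (uq) gw gh; rewrite qE -cat_rcons -cat_rcons !rcons_cat !cat_path.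
  rewrite !last_rcons => /and3P[p1 p2 p3].
  rewrite !cat_rcons cat_uniq => /and3P[u1 d1]; rewrite -cat_cons cat_uniq.
  move=> /and3P[u2 d2 u3]; rewrite rcons_cons -!cat_rcons !gain_cat !last_rcons.
  move: xq; rewrite qE mem_cat !(mem_cat, inE) !negb_or.
  move=> /and5P[xq1 xy xq2 xz xq3] gw gh.
  have zyq2 : z \notin y :: q2 by move: d2 => /= /norP[].
  have dq1 t : t \in q1 -> t \notin y :: q2 ++ z :: q3.
    by move=> tq; apply/negP => /(hasPn d1)/=; rewrite tq.
  have Jm : joined e w h (mem S') y z (gain w y (rcons q2 z)) (gain h y (rcons q2 z)).
    apply: seg => //.
    have -> : rcons (x :: q) x = (x :: q1) ++ rcons (y :: q2) z ++ rcons q3 x.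
      by rewrite cat_rcons -rcons_cons -!rcons_cat qE.
    exact: subseq_trans (prefix_subseq _ _) (suffix_subseq _ _).
  have Jo : joined e w h (mem S') z y
      (gain w z (rcons q3 x) (+) gain w x (rcons q1 y))
      (gain h z (rcons q3 x) (+) gain h x (rcons q1 y)).
    have Ja := @joined_path V e w h [predU mem (z :: q3) & pred1 x] z (rcons q3 x) p3.
    have Jb := @joined_path V e w h (mem (x :: rcons q1 y)) x (rcons q1 y) p1.
    rewrite !last_rcons in Ja Jb.
    apply: joined_sub (joined_trans (Ja _ _) (Jb _ _) _).
    - move=> t; rewrite !inE mem_rcons qE !(mem_cat, inE).
      by do !case: (t \in _); do !case: (_ == _); do ?case: (_ \in _).
    - by rewrite -rcons_cons rcons_uniq u3 inE negb_or xz xq3.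
    - by move=> t; rewrite -rcons_cons mem_rcons !inE; do !case: (_ == _); do ?case: (_ \in _).
    - rewrite /= mem_rcons inE negb_or xy xq1 rcons_uniq u1 !andbT.
      by apply/negP => /dq1; rewrite mem_head.
    - by [].
    - move=> t; rewrite [t \in [predU _ & _]]inE => /orP[tz|/eqP//].
      rewrite inE mem_rcons inE => /or3P[/eqP //|/eqP ty|/dq1].
        move: tz zyq2 d2; rewrite inE => /orP[/eqP<-|tq3].
          by rewrite ty mem_head.
        by move=> _ /= /norP[_ /hasPn/(_ t tq3)]; rewrite /= ty mem_head.
      by rewrite inE mem_cat tz !orbT.
  move: (joined_sym eC wC hC Jo) Jm gw gh.
  case: (gain w x _) (gain w y _) (gain w z _) => [] [] [];
    by case: (gain h x _) (gain h y _) (gain h z _) r => [] [] [] [].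
have split1 y : y \in q -> exists q1 q2, q = q1 ++ y :: q2.
  by case/splitPr=> q1 q2; exists q1, q2.
move=> a c r; rewrite !inE.
have [->|ax] := eqVneq a x; have [->|cx] := eqVneq c x => //= aS cS.
- by have [q1 [q2 qE]] := split1 _ cS => _; apply: one qE.
- have [q1 [q2 qE]] := split1 _ aS => _.
  by rewrite addbC; apply: joined_sym => //; apply: one qE.
- move=> ac; case: (split2 aS cS ac) => -[q1 [q2 [q3 qE]]].
    exact: two qE.
  by rewrite addbC; apply: joined_sym => //; apply: two qE.
Qed.

Lemma spread_grow S f : has_ears -> spread S f -> (1 < #|S|)%N ->
  exists f', spread setT f'.
Proof.
move=> ears; move: {2}#|~: S| (leqnn #|~: S|) => n.
elim: n S f => [|n IH] S f leSn Sf S1.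
  exists f; rewrite -setC0; move: leSn; rewrite leqn0 cards_eq0 => /eqP <-.
  by rewrite setCK.
have [ST|ST] := eqVneq S setT; first by exists f; rewrite -ST.
have nbr u : u \in S -> exists2 v, v \in S & e u v.
  move=> uS; have [v vS vu] : exists2 v, v \in S & u != v.
    have /card_gt0P[v] : (0 < #|S :\ u|)%N by rewrite (cardsD1 u) uS in S1.
    by rewrite !inE eq_sym => /andP[]; exists v.
  have [[|z p] [pp lp _ sp _]] := Sf _ _ false uS vS vu.
    by rewrite -lp eqxx in vu.
  case/andP: pp => uz _; exists z => //; apply: sp; by rewrite !inE eqxx orbT.
have S0 : S != set0 by rewrite -card_gt0; lia.
have [u [q [b [ub qE]]]] := ears S S0 ST nbr.
apply: IH (spread_ear Sf ub qE) _.
  case: qE => _ _ q0 _ qS; rewrite -ltnS (leq_trans _ leSn) // proper_card //.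
  rewrite properC; apply/properP; split; first exact: subsetUl.
  case: q q0 qS => // z q _ /(_ z); rewrite mem_head => /(_ isT) zS.
  by exists z; rewrite // !inE eqxx orbT.
by rewrite (leq_trans S1) // subset_leq_card // subsetUl.
Qed.

(** A path from [b] to [a] with the [w]-gain of the edge closes up to a simple cycle with [w = 0],
    hence with [h = 0]. A path of length one is the edge itself and gives the value directly. *)
Lemma spread_setT f : spread setT f -> forall a b, e a b -> h a b = f a (+) f b.
Proof.
move=> Tf a b ab; have ba : b != a by apply: contraTneq ab => ->; rewrite e_irr.
have [p [pp lp up _ [gw gh]]] := Tf b a (w a b) (in_setT b) (in_setT a) ba.
case: p => [|z [|z' p]] in pp lp up gw gh *.
- by rewrite -lp eqxx in ba.
- by move: gh; rewrite /= addbF -lp hC addbC.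
have cyc : simple_cycle b [:: z, z' & p].
  by split=> //; rewrite rcons_path pp lp.
have := cycle_gain cyc; rewrite !gain_rcons lp gw gh addbb => /(_ erefl).
by case: (h a b) (f a) (f b) => [] [] [].
Qed.

Lemma cycle_gain_potential x q : has_ears -> simple_cycle x q ->
  gain w x (rcons q x) = true -> gain h x (rcons q x) = false ->
  exists f, forall a b, e a b -> h a b = f a (+) f b.
Proof.
move=> ears xq gw gh; have [|f' Tf'] := spread_grow ears (spread_cycle xq gw gh).
  case: xq => _ uq sq; rewrite cardsE (card_uniqP uq) /=; lia.
by exists f'; apply: spread_setT.
Qed.

End Ears.

(** * Gains that vanish on all simple cycles *)

Section Potential.
Variables (V : finType) (e : rel V).
Hypotheses (eC : symmetric e) (e_irr : irreflexive e).
Hypothesis e_conn : forall S : {set V}, S != set0 -> S != setT ->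
  exists u v, [/\ u \in S, v \notin S & e u v].
Variable g : V -> V -> bool.
Hypothesis gC : forall u v, g u v = g v u.

(** Vertices are added one at a time by pendant edges, as in a spanning tree, and every other edge
    closes a simple path. The gain [g] takes both places in [joined], since there is no second
    parity to choose. *)
Lemma balanced_potential :
  (forall x p, simple_cycle e x p -> gain g x (rcons p x) = false) ->
  exists f, forall a b, e a b -> g a b = f a (+) f b.
Proof.
move=> cycle_gain.
pose inv (S : {set V}) f := forall a b, a \in S -> b \in S ->
  joined e g g (mem S) a b (f a (+) f b) (f a (+) f b).
have grow n (S : {set V}) f : (#|~: S| <= n)%N -> S != set0 -> inv S f ->
    exists f', inv setT f'.
  elim: n S f => [|n IH] S f leSn S0 Sf.
    exists f; rewrite -setC0; move: leSn; rewrite leqn0 cards_eq0 => /eqP <-.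
    by rewrite setCK.
  have [ST|ST] := eqVneq S setT; first by exists f; rewrite -ST.
  have [u [v [uS vS uv]]] := e_conn S0 ST.
  apply: (IH (v |: S) (fun z => if z == v then f u (+) g u v else f z)).
  - rewrite -ltnS (leq_trans _ leSn) // proper_card // properC.
    apply/properP; split; first exact: subsetUr.
    by exists v; rewrite // !inE eqxx.
  - by apply/set0Pn; exists v; rewrite !inE eqxx.
  have one b : b \in S ->
      joined e g g (mem (v |: S)) v b (f u (+) g u v (+) f b) (f u (+) g u v (+) f b).
    have Jv : joined e g g (pred2 v u) v u (g u v) (g u v).
      exists [:: u]; split=> //=.
      - by rewrite eC uv.
      - by rewrite inE andbT; apply: contraNneq vS => ->.
      - by move=> z; rewrite !inE.
      - by rewrite addbF gC.
    move=> bS; have := joined_trans Jv (Sf u b uS bS) _.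
    rewrite !addbA [g u v (+) _]addbC => J; apply: joined_sub (J _).
      by move=> z; rewrite !inE => /orP[/orP[->|/eqP->]|->]; rewrite ?uS ?orbT.
    by move=> z; rewrite inE => /orP[]/eqP -> // vS'; rewrite vS' in vS.
  move=> a b; rewrite !inE.
  have [->|av] := eqVneq a v; have [->|bv] := eqVneq b v => //= aS bS.
  - by rewrite addbb; apply: joined_refl; rewrite !inE eqxx.
  - exact: one.
  - by rewrite addbC; apply: joined_sym => //; apply: one.
  - by apply: joined_sub (Sf _ _ aS bS) => z zS; rewrite inE zS orbT.
have [x _|V0] := pickP V; last by exists xpred0 => a; have := V0 a.
have [||f Tf] := grow _ [set x] xpred0 (leqnn _).
- by apply/set0Pn; exists x; rewrite inE.
- by move=> a b; rewrite !inE => /eqP-> /eqP->; apply: joined_refl; rewrite inE.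
exists f => a b ab; have [p [pp lp up _ [gw _]]] := Tf b a (in_setT b) (in_setT a).
case: p => [|z [|z' p]] in pp lp up gw *.
- by rewrite -lp e_irr in ab.
- by move: gw; rewrite /= addbF -lp gC addbC.
have cyc : simple_cycle e b [:: z, z' & p].
  by split=> //; rewrite rcons_path pp lp.
have := cycle_gain _ _ cyc; rewrite !gain_rcons lp gw.
by case: (g a b) (f a) (f b) => [] [] [].
Qed.

End Potential.

Lemma exists_simple_cycle (V : finType) (e : rel V) (w h : V -> V -> bool) :
  symmetric e -> irreflexive e -> has_ears e ->
  (forall S : {set V}, S != set0 -> S != setT ->
    exists u v, [/\ u \in S, v \notin S & e u v]) ->
  (forall u v, w u v = w v u) -> (forall u v, h u v = h v u) ->
  (forall f k, exists u v, e u v /\ h u v != f u (+) f v (+) (k && w u v)) ->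
  exists x p, [/\ simple_cycle e x p, gain w x (rcons p x) = false
                & gain h x (rcons p x) = true].
Proof.
move=> eC e_irr ears e_conn wC hC h_nontriv; apply: NNPP => no_cycle.
have wh x p : simple_cycle e x p ->
    gain w x (rcons p x) = false -> gain h x (rcons p x) = false.
  move=> xp gw; apply/negP => gh; apply: no_cycle; by exists x, p.
(* Without a simple cycle of odd [w]-gain, [wh] makes [h] vanish on all simple cycles, and it is a
   coboundary without any ears. *)
have [[x [p [xp gw]]]|no_odd] := classic (exists x p, simple_cycle e x p /\
    gain w x (rcons p x) = true); last first.
  have [x p xp|f fE] := balanced_potential eC e_irr e_conn hC.
    apply: wh => //; apply/negP => gw; apply: no_odd; by exists x, p.
  have [u [v [uv]]] := h_nontriv f false.
  by rewrite addbF fE // eqxx.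
pose k := gain h x (rcons p x).
pose h' u v := h u v (+) (k && w u v).
have gh' y q : gain h' y q = gain h y q (+) (k && gain w y q).
  elim: q y => [|z q IH] y /=; first by rewrite andbF.
  by rewrite IH /h'; case: (k) (h y z) (w y z) (gain h z q) (gain w z q) => [] [] [] [] [].
have [|y q yq||f fE] := @cycle_gain_potential V e eC e_irr w h' wC _ _ x p ears xp gw.
- by move=> u v; rewrite /h' hC wC.
- by rewrite gh' => gy; rewrite wh // gy andbF.
- by rewrite gh' gw -/k; case: (k).
have [u [v [uv]]] := h_nontriv f k.
by rewrite -(fE u v uv) /h' -addbA addbb addbF eqxx.
Qed.

(** * Polyhedral maps *)

Section OrbitCover.
Variables (T : finType) (Z : finZmodType) (s t : T -> T) (f : T -> Z).
Hypotheses (sK : involutive s) (tK : involutive t).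
Variables s' t' : T * Z -> T * Z.
Hypothesis s'E : forall x i, s' (x, i) = (s x, i + (f (s x) - f x)).
Hypothesis t'E : forall x i, t' (x, i) = (t x, i + (f (t x) - f x)).

(** [f] is a primitive of the sheet change, so [j - f y] is invariant under both lifted involutions.
    Each kind of cell will have its own primitive: a lift [rho] for vertices, the function defining
    the covering for edges, 0 for faces. *)
Lemma mem_orb_cover x i y j :
  ((y, j) \in orb s' t' (x, i)) = (y \in orb s t x) && (j - f y == i - f x).
Proof.
have s'K : involutive s'.
  by case=> z k; rewrite !s'E sK; congr (_, _); rewrite -addrA subrKA subrr addr0.
have t'K : involutive t'.
  by case=> z k; rewrite !t'E tK; congr (_, _); rewrite -addrA subrKA subrr addr0.
apply/idP/andP.
  pose P (u : T * Z) := u.1 \in orb s t x /\ u.2 - f u.1 == i - f x.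
  apply: (@orb_ind _ s' t' _ P).
  - by split; rewrite ?mem_orb /=.
  - case=> z k [/= zx /eqP kE]; rewrite s'E; split; rewrite /= ?mem_orb_s //.
    by rewrite -kE addrA addrAC addrK.
  - case=> z k [/= zx /eqP kE]; rewrite t'E; split; rewrite /= ?mem_orb_t //.
    by rewrite -kE addrA addrAC addrK.
case=> yx; move: y yx j.
apply: orb_ind => [j|y IH j|y IH j] /eqP jE.
- by move/addIr: jE => ->; apply: mem_orb.
- rewrite -(mem_orb_s s'K t'K) s'E sK; apply: IH.
  by rewrite -jE addrA addrAC addrK.
- rewrite -(mem_orb_t s'K t'K) t'E tK; apply: IH.
  by rewrite -jE addrA addrAC addrK.
Qed.

(** An orbit of the covering is an orbit below together with the constant value of [j - f y]. *)
Lemma card_orbs_cover :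
  #|[set orb s' t' u | u : T * Z]| = (#|[set orb s t x | x : T]| * #|Z|)%N.
Proof.
pose g (vk : {set T} * Z) : {set T * Z} :=
  [set u | (u.1 \in vk.1) && (u.2 - f u.1 == vk.2)].
have orbE x i : orb s' t' (x, i) = g (orb s t x, i - f x).
  by apply/setP => -[y j]; rewrite mem_orb_cover [RHS]in_set.
have -> : [set orb s' t' u | u : T * Z]
    = g @: setX [set orb s t x | x : T] [set: Z].
  apply/setP => A; apply/imsetP/imsetP.
    case=> -[x i] _ ->; exists (orb s t x, i - f x); last exact: orbE.
    by rewrite in_setX in_setT andbT; apply: imset_f.
  case=> -[v k]; rewrite in_setX in_setT andbT /= => /imsetP[x _ ->] ->.
  by exists (x, k + f x); rewrite // orbE addrK.
rewrite card_in_imset ?cardsX ?cardsT // => -[v k] [v' k'].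
rewrite !in_setX !in_setT !andbT /= => /imsetP[x _ ->] /imsetP[x' _ ->] /setP gE.
have := gE (x, k + f x); rewrite ![_ \in g _]in_set /= mem_orb addrK eqxx.
move=> /esym/andP[xx' /eqP ->].
by rewrite (orb_eq sK tK xx').
Qed.

End OrbitCover.

Section Maps.
Variable K : cmap.
Implicit Types x y z : K.

Lemma vertex_ofE x : vertex_of x = orb (@t1 K) (@t2 K) x. Proof. by []. Qed.
Lemma edge_ofE x : edge_of x = orb (@t0 K) (@t2 K) x. Proof. by []. Qed.

Lemma vertex_of_t1 x : vertex_of (t1 x) = vertex_of x.
Proof. exact: orb_s (@t1K K) (@t2K K) x. Qed.
Lemma vertex_of_t2 x : vertex_of (t2 x) = vertex_of x.
Proof. exact: orb_t (@t1K K) (@t2K K) x. Qed.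
Lemma face_of_t0 x : face_of (t0 x) = face_of x.
Proof. exact: orb_s (@t0K K) (@t1K K) x. Qed.
Lemma face_of_t1 x : face_of (t1 x) = face_of x.
Proof. exact: orb_t (@t0K K) (@t1K K) x. Qed.
Lemma edge_of_t0 x : edge_of (t0 x) = edge_of x.
Proof. exact: orb_s (@t0K K) (@t2K K) x. Qed.
Lemma edge_of_t2 x : edge_of (t2 x) = edge_of x.
Proof. exact: orb_t (@t0K K) (@t2K K) x. Qed.

Lemma mem_vertexE x y : (y \in vertex_of x) = (vertex_of y == vertex_of x).
Proof. exact: mem_orbE (@t1K K) (@t2K K) x y. Qed.
Lemma mem_edgeE x y : (y \in edge_of x) = (edge_of y == edge_of x).
Proof. exact: mem_orbE (@t0K K) (@t2K K) x y. Qed.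
Lemma mem_faceE x y : (y \in face_of x) = (face_of y == face_of x).
Proof. exact: mem_orbE (@t0K K) (@t1K K) x y. Qed.

Lemma vertex_self x : x \in vertex_of x. Proof. exact: mem_orb. Qed.
Lemma edge_self x : x \in edge_of x. Proof. exact: mem_orb. Qed.
Lemma face_self x : x \in face_of x. Proof. exact: mem_orb. Qed.

Lemma mem_edgeP x y :
  (y \in edge_of x) = [|| y == x, y == t0 x, y == t2 x | y == t0 (t2 x)].
Proof.
apply/idP/idP; last first.
  by move/or4P=> []/eqP->; rewrite mem_edgeE ?(edge_of_t0, edge_of_t2).
rewrite edge_ofE.
apply: (@orb_ind _ (@t0 K) (@t2 K) x
  (fun y => [|| y == x, y == t0 x, y == t2 x | y == t0 (t2 x)])).
- by rewrite eqxx.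
- by move=> z /or4P[]/eqP->; rewrite ?t0K eqxx ?orbT.
- by move=> z /or4P[]/eqP->; rewrite -?t02C ?t2K eqxx ?orbT.
Qed.

Definition ends x := [set vertex_of x; vertex_of (t0 x)].

Lemma vertices_at_edge x : vertices_at (edge_of x) = ends x.
Proof.
apply/setP => v; rewrite !inE; apply/andP/orP.
  case=> /imsetP[y _ ->] /set0Pn[z]; rewrite in_setI mem_vertexE mem_edgeP.
  case/andP=> /eqP<- /or4P[]/eqP->; rewrite ?t02C ?vertex_of_t2 ?eqxx; auto.
case=> /eqP->; split; rewrite ?imset_f //; apply/set0Pn.
  by exists x; rewrite in_setI vertex_self edge_self.
by exists (t0 x); rewrite in_setI vertex_self mem_edgeE edge_of_t0 eqxx.
Qed.

Lemma vertices_at_face x : vertices_at (face_of x) = [set vertex_of y | y in face_of x].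
Proof.
apply/setP => v; rewrite inE; apply/andP/imsetP.
  case=> /imsetP[y _ ->] /set0Pn[z]; rewrite in_setI mem_vertexE.
  by case/andP=> /eqP<- zx; exists z.
case=> y yx ->; split; rewrite ?imset_f //; apply/set0Pn.
by exists y; rewrite in_setI vertex_self.
Qed.

Lemma edges_at_face x : edges_at (face_of x) = [set edge_of y | y in face_of x].
Proof.
apply/setP => v; rewrite inE; apply/andP/imsetP.
  case=> /imsetP[y _ ->] /set0Pn[z]; rewrite in_setI mem_edgeE.
  by case/andP=> /eqP<- zx; exists z.
case=> y yx ->; split; rewrite ?imset_f //; apply/set0Pn.
by exists y; rewrite in_setI edge_self.
Qed.

Hypothesis polyK : polyhedral K.
Hypothesis face3 : forall f, f \in faces K -> (2 < face_length f)%N.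

Lemma face_vertex_inj x y : vertex_of y = vertex_of x -> face_of y = face_of x ->
  y = x \/ y = t1 x.
Proof. by move=> vE fE; apply: polyK.1; rewrite (mem_vertexE, mem_faceE); apply/eqP. Qed.

Lemma no_digon x u v : ~ {in face_of x, forall y, vertex_of y \in [set u; v]}.
Proof.
move=> digon; have := face3 (imset_f (@face_of K) (isT : x \in predT)).
rewrite ltnNge /face_length vertices_at_face; case/negP.
apply: leq_trans (_ : #|[set u; v]| <= 2)%N; last by rewrite cards2; case: (_ == _).
by apply/subset_leq_card/subsetP => _ /imsetP[y yx ->]; apply: digon.
Qed.

Lemma ends_neq x : vertex_of (t0 x) != vertex_of x.
Proof.
apply/eqP => v0; have [x0|x01] := face_vertex_inj v0 (face_of_t0 x).
  by have := t0_neq x; rewrite x0 eqxx.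
apply: (@no_digon x (vertex_of x) (vertex_of x)) => y yx.
suff /orP[] : (y == x) || (y == t0 x) by move=> /eqP->; rewrite in_set2 ?v0 eqxx.
move: y yx; apply: orb_ind; first by rewrite eqxx.
  by move=> z /orP[]/eqP->; rewrite ?t0K eqxx ?orbT.
by move=> z /orP[]/eqP->; rewrite x01 ?t1K eqxx ?orbT.
Qed.

(** Otherwise [t0 (t1 x)] and [t1 (t0 x)] coincide, and the face closes up with two vertices. *)
Lemma corner_neq x : vertex_of (t0 (t1 x)) != vertex_of (t0 x).
Proof.
apply/eqP => v01; have fE : face_of (t0 (t1 x)) = face_of (t0 x).
  by rewrite !face_of_t0 face_of_t1.
have [/(can_inj (@t0K K)) x1|x01] := face_vertex_inj v01 fE.
  by have := t1_neq x; rewrite x1 eqxx.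
apply: (@no_digon x (vertex_of x) (vertex_of (t0 x))) => y yx.
suff /or4P[] : [|| y == x, y == t0 x, y == t1 x | y == t1 (t0 x)].
- by move/eqP->; rewrite in_set2 eqxx.
- by move/eqP->; rewrite in_set2 eqxx orbT.
- by move/eqP->; rewrite in_set2 vertex_of_t1 eqxx.
- by move/eqP->; rewrite in_set2 vertex_of_t1 eqxx orbT.
move: y yx; apply: orb_ind; first by rewrite eqxx.
  by move=> z /or4P[]/eqP->; rewrite ?t0K -?x01 ?t0K ?x01 eqxx ?orbT.
by move=> z /or4P[]/eqP->; rewrite ?t1K eqxx ?orbT.
Qed.

Lemma edge_corner x e : e \in edges_at (face_of x) ->
  vertex_of x \in vertices_at e ->
  exists2 z, z = x \/ z = t1 x & edge_of z = e.
Proof.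
rewrite edges_at_face => /imsetP[z zx ->]; rewrite vertices_at_edge in_set2.
move: zx; rewrite mem_faceE => /eqP zx /orP[]/eqP vx.
  by exists z => //; apply: face_vertex_inj.
exists (t0 z); last exact: edge_of_t0.
by apply: face_vertex_inj; rewrite ?face_of_t0.
Qed.

(** Polyhedrality at a chosen common vertex, in terms of flags: a common edge must be an edge of the
    corner at [x], and crossing it by [t2] leads to the corner at [y]. In this form the property
    lifts to coverings. *)
Lemma faces_meet x y : vertex_of y = vertex_of x -> face_of y != face_of x ->
  let V := vertices_at (face_of x) :&: vertices_at (face_of y) in
  let E := edges_at (face_of x) :&: edges_at (face_of y) in
  (V = [set vertex_of x] /\ E = set0) \/
  exists z, [/\ z = x \/ z = t1 x, t2 z = y \/ t2 z = t1 y,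
                V = ends z & E = [set edge_of z]].
Proof.
move=> vE fE V E; have xV : vertex_of x \in V.
  by rewrite in_setI !vertices_at_face imset_f ?face_self // -vE imset_f ?face_self.
have [||||[v _ [VE EE]]|[e _ [VE EE]]] :=
    polyK.2 (face_of x) (face_of y); rewrite ?imset_f //.
- by rewrite eq_sym.
- by apply/set0Pn; exists (vertex_of x).
- by left; split; rewrite // /V VE; move: xV; rewrite /V VE in_set1 => /eqP->.
right; have eE : e \in E by rewrite /E EE set11.
have xe : vertex_of x \in vertices_at e by rewrite -VE.
move: eE; rewrite in_setI => /andP[ex ey].
have [z zx zE] := edge_corner ex xe.
have [y' yy' y'E] : exists2 z, z = y \/ z = t1 y & edge_of z = e.
  by apply: edge_corner ey _; rewrite vE.
have vz : vertex_of z = vertex_of x by case: zx => ->; rewrite ?vertex_of_t1.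
have vy : vertex_of y' = vertex_of z by rewrite vz -vE; case: yy' => ->; rewrite ?vertex_of_t1.
exists z; rewrite /V VE /E EE -zE vertices_at_edge; split=> //.
suff -> : t2 z = y' by [].
have : y' \in edge_of z by rewrite mem_edgeE zE y'E.
rewrite mem_edgeP => /or4P[]/eqP y'z; first 1 last.
- by have := ends_neq z; rewrite -y'z vy eqxx.
- by [].
- by have := ends_neq z; rewrite -vy y'z t02C vertex_of_t2 eqxx.
case/eqP: fE; have -> : face_of y = face_of y' by case: yy' => ->; rewrite ?face_of_t1.
by rewrite y'z; case: zx => ->; rewrite ?face_of_t1.
Qed.

(** On one face, [corner_neq] excludes parallel edges. Two distinct faces would share both ends, so
    they meet in an edge with these ends, and both flags lie on it. *)
Lemma no_multi_edge x y : vertex_of y = vertex_of x ->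
  vertex_of (t0 y) = vertex_of (t0 x) -> y \in edge_of x.
Proof.
move=> vE v0E; have [fE|fE] := eqVneq (face_of y) (face_of x).
  have [->|yx] := face_vertex_inj vE fE; first exact: edge_self.
  by have := corner_neq x; rewrite -v0E yx eqxx.
have v0V : vertex_of (t0 x) \in vertices_at (face_of x) :&: vertices_at (face_of y).
  rewrite in_setI !vertices_at_face.
  rewrite -{1}(face_of_t0 x) -(face_of_t0 y) imset_f ?face_self //.
  by rewrite -v0E imset_f ?face_self.
have [[VE _]|[z [zx zy VE _]]] := faces_meet vE fE.
  by move: v0V; rewrite VE in_set1 (negbTE (ends_neq x)).
move: v0V; rewrite VE in_set2.
have -> : vertex_of z = vertex_of x by case: zx => ->; rewrite ?vertex_of_t1.
rewrite (negbTE (ends_neq x)) /= => /eqP v0z.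
have zE : z = x.
  by case: zx => // zx; have := corner_neq x; rewrite v0z zx eqxx.
rewrite mem_edgeP; case: zy => [<-|t2z]; first by rewrite zE eqxx ?orbT.
have := corner_neq y.
by rewrite -t2z t02C vertex_of_t2 v0E v0z eqxx.
Qed.

End Maps.

(** * Cyclic coverings *)

Lemma connectedP (M : cmap) : connected M <->
  (exists x : M, True) /\ forall x y : M, connect (@adj_rel M) x y.
Proof.
rewrite /connected /components; split=> [/eqP/cards1P[A AE]|[[x _] xM]].
  have compE x : component_of x = A by apply/set1P; rewrite -AE imset_f.
  have AM : A \in [set component_of x | x : M] by rewrite AE set11.
  split=> [|x y]; first by case/imsetP: AM => x _ _; exists x.
  have : y \in component_of x by rewrite compE -(compE y) in_set connect0.
  by rewrite in_set.
apply/eqP/cards1P; exists (component_of x); apply/setP => A; rewrite in_set1.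
apply/imsetP/eqP => [[y _ ->]|->]; last by exists x.
by apply/setP => z; rewrite !in_set !xM.
Qed.

Lemma connected_closed (M : cmap) (S : {set M}) : connected M -> S != set0 ->
  (forall x, x \in S -> [/\ t0 x \in S, t1 x \in S & t2 x \in S]) -> S = setT.
Proof.
move=> /connectedP[_ cM] /set0Pn[x xS] Scl; apply/setP => y; rewrite in_setT.
have /connectP[p] := cM x y; elim: p x xS => [|z p IH] x xS; first by move=> _ ->.
case/andP=> xz pz yE; apply: IH pz yE.
by have [S0 S1 S2] := Scl x xS; case/or3P: xz => /eqP->.
Qed.

Lemma closed_connected (M : cmap) (x0 : M) :
  (forall S : {set M}, S != set0 ->
     (forall x, x \in S -> [/\ t0 x \in S, t1 x \in S & t2 x \in S]) -> S = setT) ->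
  connected M.
Proof.
move=> Mcl; apply/connectedP; split=> [|x y]; first by exists x0.
have := in_setT y; rewrite -(Mcl [set z | connect (@adj_rel M) x z]) ?in_set //.
  by apply/set0Pn; exists x; rewrite in_set connect0.
move=> z; rewrite !in_set => xz.
by split; apply: connect_trans xz (connect1 _); rewrite /adj_rel /= eqxx ?orbT.
Qed.

Lemma map_traject (A B : Type) (p : A -> B) (F : A -> A) (G : B -> B) u k :
  (forall v, p (F v) = G (p v)) -> map p (traject F u k) = traject G (p u) k.
Proof. by move=> pF; elim: k u => //= k IH u; rewrite IH pF. Qed.

Section Cover.
Variables (K : cmap) (n : nat) (f : K -> 'I_n.+2).
Hypothesis f0 : forall x, f (t0 x) = f x.

Let T : finType := (K * 'I_n.+2)%type.
Let c0 (u : T) : T := (t0 u.1, u.2).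
Let c1 (u : T) : T := (t1 u.1, u.2).
Let c2 (u : T) : T := (t2 u.1, u.2 + (f (t2 u.1) - f u.1)).

Let c0K : involutive c0. Proof. by case=> x i; rewrite /c0 /= t0K. Qed.
Let c1K : involutive c1. Proof. by case=> x i; rewrite /c1 /= t1K. Qed.
Let c2K : involutive c2.
Proof. by case=> x i; rewrite /c2 /= t2K -addrA subrKA subrr addr0. Qed.
Let c02C u : c0 (c2 u) = c2 (c0 u).
Proof. by case: u => x i; rewrite /c0 /c2 /= -t02C !f0. Qed.
Let c0_neq u : c0 u != u.
Proof. by case: u => x i; rewrite xpair_eqE negb_and t0_neq. Qed.
Let c1_neq u : c1 u != u.
Proof. by case: u => x i; rewrite xpair_eqE negb_and t1_neq. Qed.
Let c02_neq u : c0 (c2 u) != u.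
Proof. by case: u => x i; rewrite xpair_eqE negb_and t02_neq. Qed.

(* The cyclic covering in which crossing an edge at a flag [x] changes the sheet
   by [f (t2 x) - f x]. *)
Definition sheet_cover : cmap := CMap c0K c1K c2K c02C c0_neq c1_neq c02_neq.

(* A lift of the sheet number that is constant around each vertex exists
   exactly when the covering is unbranched. *)
Variable rho : K -> 'I_n.+2.
Hypothesis rho1 : forall x, rho (t1 x) = rho x.
Hypothesis rho2 : forall x, rho (t2 x) - rho x = f (t2 x) - f x.

Lemma mem_vertex_cover x i y j :
  (((y, j) : sheet_cover) \in @vertex_of sheet_cover (x, i))
  = (y \in vertex_of x) && (j - rho y == i - rho x).
Proof.
apply: (@mem_orb_cover K _ (@t1 K) (@t2 K) rho (@t1K K) (@t2K K) c1 c2).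
- by move=> z k; rewrite rho1 subrr addr0.
- by move=> z k; rewrite rho2.
Qed.

Lemma mem_edge_cover x i y j :
  (((y, j) : sheet_cover) \in @edge_of sheet_cover (x, i))
  = (y \in edge_of x) && (j - f y == i - f x).
Proof.
apply: (@mem_orb_cover K _ (@t0 K) (@t2 K) f (@t0K K) (@t2K K) c0 c2) => // z k.
by rewrite f0 subrr addr0.
Qed.

Lemma mem_face_cover x i y j :
  (((y, j) : sheet_cover) \in @face_of sheet_cover (x, i)) = (y \in face_of x) && (j == i).
Proof.
have := @mem_orb_cover K _ (@t0 K) (@t1 K) (fun=> 0) (@t0K K) (@t1K K) c0 c1.
move=> /(_ _ _ x i y j); rewrite !subr0; apply=> z k; by rewrite addr0.
Qed.

Lemma euler_cover : euler sheet_cover = euler K * n.+2%:Z.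
Proof.
have Vc : #|vertices sheet_cover| = (#|vertices K| * n.+2)%N.
  rewrite -[in RHS](card_ord n.+2).
  apply: (@card_orbs_cover K _ (@t1 K) (@t2 K) rho (@t1K K) (@t2K K) c1 c2).
  - by move=> z k; rewrite rho1 subrr addr0.
  - by move=> z k; rewrite rho2.
have Ec : #|edges sheet_cover| = (#|edges K| * n.+2)%N.
  rewrite -[in RHS](card_ord n.+2).
  apply: (@card_orbs_cover K _ (@t0 K) (@t2 K) f (@t0K K) (@t2K K) c0 c2) => // z k.
  by rewrite f0 subrr addr0.
have Fc : #|faces sheet_cover| = (#|faces K| * n.+2)%N.
  rewrite -[in RHS](card_ord n.+2).
  apply: (@card_orbs_cover K _ (@t0 K) (@t1 K) (fun=> 0) (@t0K K) (@t1K K) c0 c1);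
    by move=> z k; rewrite subrr addr0.
by rewrite /euler Vc Ec Fc !PoszM; ring.
Qed.

Lemma iter_turn_cover k x i : let y := iter k (@turn K) x in
  iter k (@turn sheet_cover) (x, i) = (y, i + (rho y - rho x)).
Proof.
elim: k => [|k IH] /=; first by rewrite subrr addr0.
rewrite IH; congr (_, _); rewrite -rho2 rho1 -addrA.
by congr (_ + _); rewrite addrC subrKA.
Qed.

(** By [rho], a rotation that returns to a flag of [K] also returns to its sheet, so the projection
    is injective on the orbit. This is how the absence of branching preserves face-cycles. *)
Lemma orbit_turn_cover x i :
  [seq u.1 | u <- orbit (@turn sheet_cover) (x, i)] = orbit (@turn K) x.
Proof.
rewrite /orbit (@map_traject _ _ _ _ (@turn K)) //; congr traject.
rewrite /order -(card_in_image (f := fst)); last first.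
  move=> u v /iter_findex <- /iter_findex <-.
  by rewrite !iter_turn_cover /= => ->.
apply: eq_card => y; apply/imageP/idP => [[u /iter_findex <- ->]|].
  by rewrite iter_turn_cover; apply: fconnect_iter.
move=> /iter_findex yE; pose k := findex (@turn K) x y.
exists (iter k (@turn sheet_cover) (x, i)); first exact: fconnect_iter.
by rewrite iter_turn_cover.
Qed.

(** * Polyhedrality of the covering *)

Section Polyhedral.
Hypotheses (bK : boundaryless K) (polyK : polyhedral K).
Hypothesis face3 : forall F, F \in faces K -> (2 < face_length F)%N.

Lemma boundaryless_cover : boundaryless sheet_cover.
Proof. by case=> x i; rewrite /= xpair_eqE negb_and bK. Qed.

Lemma vertex_cover_fst (x y : K) i j :
  @vertex_of sheet_cover (x, i) = @vertex_of sheet_cover (y, j) -> vertex_of x = vertex_of y.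
Proof.
by move/eqP; rewrite -mem_vertexE mem_vertex_cover mem_vertexE => /andP[/eqP].
Qed.

Lemma edge_cover_fst (x y : K) i j :
  @edge_of sheet_cover (x, i) = @edge_of sheet_cover (y, j) -> edge_of x = edge_of y.
Proof.
by move/eqP; rewrite -mem_edgeE mem_edge_cover mem_edgeE => /andP[/eqP].
Qed.

(** The projection is injective on the vertices of a lifted face: two of its flags over one vertex
    differ at most by [t1], which stays in the sheet. *)
Lemma face_length_cover (u : sheet_cover) : face_length (face_of u) = face_length (face_of u.1).
Proof.
case: u => x i; rewrite /face_length !vertices_at_face /=.
pose pr (A : {set sheet_cover}) : {set K} := [set u.1 | u in A].
have prE y j : pr (@vertex_of sheet_cover (y, j)) = vertex_of y.
  apply/setP => z; apply/imsetP/idP => [[[z' k]]|zy].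
    by rewrite mem_vertex_cover => /andP[zy _] ->.
  exists (z, rho z + (j - rho y)) => //.
  by rewrite mem_vertex_cover zy addrAC subrr add0r eqxx.
rewrite -(card_in_imset (f := pr)).
  apply: eq_card => v; apply/imsetP/imsetP.
    case=> A /imsetP[[y j]]; rewrite mem_face_cover => /andP[yx _] -> ->.
    by exists y.
  case=> y yx ->; exists (@vertex_of sheet_cover (y, i)); rewrite ?prE //.
  by apply: imset_f; rewrite mem_face_cover yx eqxx.
move=> _ _ /imsetP[[y j] yx ->] /imsetP[[z k] zx ->].
move: yx zx; rewrite !mem_face_cover !mem_faceE.
move=> /andP[/eqP yx /eqP ->] /andP[/eqP zx /eqP ->]; rewrite !prE => yz.
have [->|->] // := face_vertex_inj polyK yz (etrans yx (esym zx)).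
exact: (@vertex_of_t1 sheet_cover (z, i)).
Qed.

(** Distinct faces with a common vertex lie over distinct faces, and each vertex of a face has one
    lift on the lifted face. The intersection thus lies over a vertex or an edge; in the second case
    the edge lifts, through the common vertex, into both faces. *)
Lemma polyhedral_cover : polyhedral sheet_cover.
Proof.
split=> [[x i] [y j]|_ _ /imsetP[[x0 i0] _ ->] /imsetP[[y0 j0] _ ->] + meet].
  rewrite mem_vertex_cover mem_face_cover => /andP[yv _] /andP[yf /eqP->].
  by case: (polyK.1 x y yv yf) => ->; auto.
case/set0Pn: meet => v /setIP[]; rewrite {1}vertices_at_face.
case/imsetP=> -[x i] xx0 -> {v}; rewrite {1}vertices_at_face.
case/imsetP=> -[y j] yy0 vE.
move: xx0 yy0; rewrite !mem_faceE => /eqP <- /eqP <- fE {x0 i0 y0 j0}.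
have vyx := esym (vertex_cover_fst vE).
have yxj : j - rho y = i - rho x.
  by move/esym/eqP: vE; rewrite -mem_vertexE mem_vertex_cover => /andP[_ /eqP].
(* Over a single face, the common vertex would force equal sheets, hence equal faces. *)
have fyx : face_of y != face_of x.
  apply: contraNneq fE => fyx; rewrite eq_sym -mem_faceE mem_face_cover mem_faceE.
  rewrite fyx eqxx /=; case: (face_vertex_inj polyK vyx fyx) yxj => ->.
    by move/addIr->.
  by rewrite rho1 => /addIr->.
have liftE z k z' k' : (z', k') \in @face_of sheet_cover (z, k) ->
    [/\ face_of z' = face_of z, z' \in face_of z & k' = k].
  by rewrite mem_face_cover => /andP[zz' /eqP]; split=> //; apply/eqP; rewrite -mem_faceE.
have VI A : A \in vertices_at (@face_of sheet_cover (x, i))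
        :&: vertices_at (@face_of sheet_cover (y, j)) ->
    exists x', [/\ x' \in face_of x, A = @vertex_of sheet_cover (x', i) &
      vertex_of x' \in vertices_at (face_of x) :&: vertices_at (face_of y)].
  rewrite in_setI !vertices_at_face => /andP[/imsetP[[x' i'] /liftE[_ xx' ->] ->]].
  case/imsetP=> -[y' j'] /liftE[_ yy' ->] /vertex_cover_fst vx'y'.
  by exists x'; rewrite in_setI imset_f // vx'y' imset_f.
have EI A : A \in edges_at (@face_of sheet_cover (x, i))
        :&: edges_at (@face_of sheet_cover (y, j)) ->
    exists x', [/\ x' \in face_of x, A = @edge_of sheet_cover (x', i) &
      edge_of x' \in edges_at (face_of x) :&: edges_at (face_of y)].
  rewrite in_setI !edges_at_face => /andP[/imsetP[[x' i'] /liftE[_ xx' ->] ->]].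
  case/imsetP=> -[y' j'] /liftE[_ yy' ->] /edge_cover_fst vx'y'.
  by exists x'; rewrite in_setI imset_f // vx'y' imset_f.
have same x' z : x' \in face_of x -> z \in face_of x -> vertex_of x' = vertex_of z ->
    @vertex_of sheet_cover (x', i) = @vertex_of sheet_cover (z, i).
  rewrite !mem_faceE => /eqP fx' /eqP fz vz.
  have [->|->] // := face_vertex_inj polyK vz (etrans fx' (esym fz)).
  exact: (@vertex_of_t1 sheet_cover (z, i)).
have [[VE EE]|[z [zx zy VE EE]]] := faces_meet polyK face3 vyx fyx.
  left; exists (@vertex_of sheet_cover (x, i)); first exact: imset_f.
  split; apply/setP => A.
    rewrite in_set1; apply/idP/eqP => [/VI[x' [xx' -> +]]|->].
      by rewrite VE in_set1 => /eqP; apply: same => //; apply: face_self.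
    by rewrite in_setI {2}vE !vertices_at_face !imset_f ?(@face_self sheet_cover).
  by rewrite in_set0; apply/negP => /EI[x' [_ _ +]]; rewrite EE in_set0.
have fzx : face_of z = face_of x by case: zx => ->; rewrite ?face_of_t1.
pose u : sheet_cover := (z, i).
have fu : @face_of sheet_cover (x, i) = face_of u.
  by apply/eqP; rewrite -mem_faceE mem_face_cover mem_faceE fzx !eqxx.
(* Crossing the common edge arrives in the sheet of the second face because both sheets are compared
   by [rho] at the common vertex. *)
have fu2 : @face_of sheet_cover (y, j) = face_of (t2 u).
  have rz : rho z = rho x by case: zx => ->; rewrite ?rho1.
  have ry : rho (t2 z) = rho y by case: zy => ->; rewrite ?rho1.
  apply/eqP; rewrite -mem_faceE mem_face_cover mem_faceE /= -rho2 ry rz.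
  apply/andP; split; first by case: zy => ->; rewrite ?face_of_t1 eqxx.
  by rewrite addrCA -yxj addrC subrK.
have ut : t0 u \in face_of u by rewrite mem_faceE face_of_t0.
right; exists (edge_of u); first exact: imset_f.
split; apply/setP => A.
  apply/idP/idP => [/VI[x' [xx' -> +]]|].
    rewrite VE vertices_at_edge !in_set2 => /orP[]/eqP vx'.
      by rewrite (same _ z) ?eqxx // mem_faceE fzx.
    by rewrite (same _ (t0 z)) ?eqxx ?orbT // mem_faceE face_of_t0 fzx.
  rewrite vertices_at_edge in_set2 in_setI fu fu2 !vertices_at_face.
  case/orP=> /eqP->; rewrite imset_f ?face_self //.
    by rewrite -vertex_of_t2 imset_f ?face_self.
  by rewrite -vertex_of_t2 -t02C imset_f // mem_faceE face_of_t0.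
rewrite in_set1; apply/idP/eqP => [/EI[x' [xx' -> +]]|->]; last first.
  rewrite in_setI fu fu2 !edges_at_face imset_f ?face_self //.
  by rewrite -edge_of_t2 imset_f ?face_self.
rewrite EE in_set1 -mem_edgeE mem_edgeP => /or4P[]/eqP x'E.
- by rewrite x'E.
- by rewrite x'E -[RHS](edge_of_t0 u).
all: case/eqP: fyx; move: xx'; rewrite mem_faceE x'E ?face_of_t0 => /eqP <-.
all: by case: zy => ->; rewrite ?face_of_t1.
Qed.

End Polyhedral.

(** By the first hypothesis each sheet is connected under the moves that stay in it. An invariant
    set meeting one sheet therefore contains it, and the crossing at [x1] carries it to the next
    sheet, hence to all of them. *)
Lemma semi_equivelar_cover X :
  (forall S : {set K}, S != set0 -> (forall x, x \in S ->
     [/\ t0 x \in S, t1 x \in S & f (t2 x) = f x -> t2 x \in S]) -> S = setT) ->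
  (exists x, f (t2 x) = f x + 1) ->
  (forall F, F \in faces K -> (2 < face_length F)%N) ->
  semi_equivelar X K -> semi_equivelar X sheet_cover.
Proof.
move=> Kcl [x1 x1E] face3 [bK cK pK wfX typeX]; split=> //.
- exact: boundaryless_cover.
- apply: (@closed_connected sheet_cover (x1, 0)) => S S0 Scl.
  pose sheet i : {set K} := [set x | (x, i) \in S].
  have sheetT i : sheet i != set0 -> sheet i = setT.
    move=> i0; apply: Kcl => // x; rewrite !in_set => /Scl[S0' S1 S2].
    split=> // fx; have : ((t2 x, i + (f (t2 x) - f x)) : sheet_cover) \in S := S2.
    by rewrite fx subrr addr0.
  have next i : sheet i = setT -> sheet (i + 1) = setT.
    move=> iT; apply: sheetT; apply/set0Pn; exists (t2 x1).
    have /Scl[_ _ S2] : ((x1, i) : sheet_cover) \in S by have := in_setT x1; rewrite -iT in_set.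
    have : ((t2 x1, i + (f (t2 x1) - f x1)) : sheet_cover) \in S := S2.
    by rewrite x1E addrAC subrr add0r in_set.
  case/set0Pn: S0 => -[x i0] xS.
  have all_sheets k : sheet (i0 + k%:R) = setT.
    elim: k => [|k IH]; last by rewrite mulrSr addrA next.
    by rewrite addr0; apply: sheetT; apply/set0Pn; exists x; rewrite in_set.
  apply/setP => -[y j]; rewrite in_setT.
  have := in_setT y; rewrite -(all_sheets (j - i0)) in_set.
  by rewrite natr_Zp addrC subrK.
- exact: polyhedral_cover.
move=> _ /imsetP[[x0 i0] _ ->].
have [x xx0 xE] := typeX _ (imset_f (@vertex_of K) (isT : x0 \in predT)).
(* The sheet in which [x] belongs to the vertex of [(x0, i0)]. *)
exists (x, rho x + (i0 - rho x0)).
  by rewrite mem_vertex_cover xx0 addrAC subrr add0r eqxx.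
rewrite -{}xE /face_cycle -!map_comp -(orbit_turn_cover x (rho x + (i0 - rho x0))).
by rewrite -map_comp; apply: eq_map => u /=; rewrite face_length_cover.
Qed.

End Cover.

(** * Potentials around a vertex *)

Section OrbitPotential.
Variables (T : finType) (s t : T -> T).
Hypotheses (sK : involutive s) (tK : involutive t).
Hypotheses (s_neq : forall x, s x != x) (t_neq : forall x, t x != x).
Variables (Z : zmodType) (f : T -> Z).
Let o := colour s t.
Let r x := odflt x [pick y in orb s t x].

Lemma sum_colour_t (F : T -> Z) x b :
  \sum_(z in orb s t x | o z == b) F z
  = \sum_(z in orb s t x | o z == ~~ b) F (t z).
Proof.
rewrite (reindex_onto t t) => [|z _]; last exact: tK.
apply: eq_bigl => z; rewrite tK eqxx andbT mem_orb_t //.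
by rewrite /o colour_t //; case: (colour _ _ z) b => -[].
Qed.

Hypothesis sum0 : forall x,
  \sum_(z in orb s t x | o z == true) f z = \sum_(z in orb s t x | o z == false) f z.

(** [rho] adds up the jumps of [f] met when turning from a root of the orbit. It is consistent
    because the jumps over a full turn amount to the difference between the sums of [f] over the two
    colours, which is zero. *)
Lemma orb_potential : exists rho : T -> Z,
  (forall x, rho (s x) = rho x) /\ (forall x, rho (t x) - rho x = f (t x) - f x).
Proof.
pose turn := t \o s; pose d z := f (turn z) - f (s z).
(* Of [x] and [s x], only the flag of colour true is reached by turning from the root. *)
pose y x := if o x then x else s x.
pose rho x := \sum_(l < findex turn (r x) (y x)) d (iter l turn (r x)).
have rhos x : rho (s x) = rho x.
  rewrite /rho /r (@colour_root_orb _ s t sK tK x) ?mem_orb_s ?mem_orb //.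
  by rewrite /y /o colour_s //; case: (colour s t x); rewrite ?sK.
have d0 x : \sum_(l < order turn x) d (iter l turn x) = 0.
  have -> : \sum_(l < order turn x) d (iter l turn x) = \sum_(z <- orbit turn x) d z.
    rewrite (big_nth x) size_orbit big_mkord; apply: eq_bigr => l _.
    by rewrite nth_traject.
  rewrite big_uniq ?orbit_uniq //=.
  have -> : \sum_(z in orbit turn x) d z = \sum_(z in orb s t x | o z == o x) d z.
    apply: eq_bigl => z; apply/idP/andP => [zx|[zx /eqP]].
      split; first exact: orbit_rot_sub.
      move: zx; rewrite -fconnect_orbit => /iter_findex <-; apply/eqP.
      by elim: (findex _ _ _) => //= k IH; rewrite /o colour_rot.
    exact: colour_orbit.
  rewrite sumrB; apply/eqP; rewrite subr_eq0; apply/eqP.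
  have sum0' b : \sum_(z in orb s t x | o z == b) f z
      = \sum_(z in orb s t x | o z == ~~ b) f z.
    by case: b; rewrite sum0.
  have E1 := sum_colour_swap sK tK s_neq t_neq f x (~~ o x).
  have E2 := sum_colour_swap sK tK s_neq t_neq (f \o t) x (~~ o x).
  rewrite negbK in E1 E2.
  rewrite -[RHS]E1 -sum0' [RHS]sum_colour_t; exact: esym E2.
have rot x : o x -> rho (turn x) = rho x + d x.
  move=> ox; have rE : r (turn x) = r x.
    by rewrite /r (@colour_root_orb _ s t sK tK x) /turn /= ?mem_orb_t ?mem_orb_s ?mem_orb.
  have xr : fconnect turn (r x) x by rewrite fconnect_orbit.
  have yE z : o z -> y z = z by rewrite /y => ->.
  have oturn : o (turn x) by rewrite /o colour_rot.
  rewrite /rho rE !yE //; move: (findex_max xr) (iter_findex xr).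
  set k := findex turn (r x) x; rewrite leq_eqVlt => /orP[/eqP kE|kl] xE.
    have tr : turn x = r x.
      by rewrite -[in LHS]xE -iterS kE iter_order //; exact: (dihedral_rot_inj sK tK).
    rewrite tr findex0 big_ord0.
    by have := d0 (r x); rewrite -kE big_ord_recr /= xE.
  have -> : turn x = iter k.+1 turn (r x) by rewrite iterS xE.
  by rewrite findex_iter // big_ord_recr /= xE.
have rhot x : ~~ o x -> rho (t x) - rho x = f (t x) - f x.
  move=> ox; have osx : o (s x) by rewrite /o colour_s.
  by have := rot _ osx; rewrite /d /turn /= sK rhos => ->; rewrite addrAC subrr add0r.
exists rho; split=> // x; have [ox|/rhot//] := boolP (o x).
have := rhot (t x); rewrite tK /o colour_t // negbK => /(_ ox) e.
by apply: oppr_inj; rewrite !opprB.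
Qed.
End OrbitPotential.

Lemma next_next_size (T : eqType) (c : seq T) x : uniq c -> x \in c ->
  next c (next c x) = x -> (size c <= 2)%N.
Proof.
move=> uc xc; have [i c' cE] := rot_to xc.
rewrite -!(next_rot i uc) -(size_rot i) cE.
have : uniq (x :: c') by rewrite -cE rot_uniq.
case: c' {cE} => [|a [|b c']] //=; rewrite !inE eqxx !negb_or.
case/andP=> /and3P[xa xb _] _; rewrite eq_sym (negbTE xa) eqxx => bx.
by rewrite bx eqxx in xb.
Qed.

(** * Cutting along a coherent cycle *)

Lemma uniq_map_inj (T S : eqType) (f : T -> S) (s : seq T) :
  uniq (map f s) -> {in s &, injective f}.
Proof.
elim: s => //= a s IH /andP[fa /IH inj] x y; rewrite !inE.
case/predU1P=> [->|xs] /predU1P[->|ys] // fE; last exact: inj.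
- by rewrite fE map_f in fa.
- by rewrite -fE map_f in fa.
Qed.

Section Cycle.
Variable K : cmap.
Hypothesis bK : boundaryless K.

Definition flag_colour : K -> bool := colour (@t1 K) (@t2 K).
Local Notation o := flag_colour.

Lemma flag_colour_t2 x : o (t2 x) = ~~ o x.
Proof. exact: colour_t (@t1K K) (@t2K K) (@t1_neq K) bK x. Qed.

(* The flags of a coherent chain lie on one side of it: traversing an edge
   reverses the local orientation exactly when the next flag has it reversed. *)
Definition coherent : rel K :=
  [rel x y | (vertex_of (t0 x) == vertex_of y) && (o (t0 x) == ~~ o y)].

Variable c : seq K.
Hypotheses (uniq_c : uniq [seq vertex_of x | x <- c]) (size_c : (2 < size c)%N).
Hypothesis coh_c : cycle coherent c.

Let uc : uniq c. Proof. exact: map_uniq uniq_c. Qed.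

Lemma cycle_flag_inj x y : x \in c -> y \in c -> vertex_of x = vertex_of y -> x = y.
Proof. by move=> xc yc; apply: (uniq_map_inj uniq_c). Qed.

Lemma vertex_next x : x \in c -> vertex_of (t0 x) = vertex_of (next c x).
Proof. by move=> /(next_cycle coh_c)/andP[/eqP]. Qed.

Lemma colour_next x : x \in c -> o (t0 x) = ~~ o (next c x).
Proof. by move=> /(next_cycle coh_c)/andP[_ /eqP]. Qed.

Lemma next_unique x y : x \in c -> y \in c -> vertex_of y = vertex_of (t0 x) ->
  y = next c x.
Proof.
move=> xc yc yx; apply: cycle_flag_inj; rewrite ?mem_next //.
by rewrite yx vertex_next.
Qed.

Lemma t2_notin_cycle x : x \in c -> t2 x \notin c.
Proof.
move=> xc; apply/negP => x2c; have := bK x.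
by rewrite (@cycle_flag_inj (t2 x) x) ?vertex_of_t2 ?eqxx.
Qed.

Lemma t0_notin_cycle x : x \in c -> t0 x \notin c.
Proof.
move=> xc; apply/negP => x0c; have := colour_next xc.
by rewrite -(next_unique xc x0c) //; case: (o _).
Qed.

(** Colours do not exclude this flag: [t0 (t2 x)] has the colour of [next c x]. If it were that
    flag, the cycle would go straight back, which its length forbids. *)
Lemma t02_notin_cycle x : x \in c -> t0 (t2 x) \notin c.
Proof.
move=> xc; apply/negP => yc; have yE : t0 (t2 x) = next c x.
  by apply: next_unique; rewrite // t02C vertex_of_t2.
have : next c (next c x) = x.
  apply: cycle_flag_inj; rewrite ?mem_next // -vertex_next ?mem_next //.
  by rewrite -yE t0K vertex_of_t2.
by move/(next_next_size uc xc); rewrite leqNgt size_c.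
Qed.

Lemma mem_edge_flagsP z : reflect
  (exists2 x, x \in c & [\/ z = x, z = t0 x, z = t2 x | z = t0 (t2 x)])
  (z \in edge_flags c).
Proof.
rewrite in_set; apply: (iffP hasP) => -[x xc].
  by rewrite mem_edgeP => /or4P[]/eqP ->; exists x; auto using Or41, Or42, Or43, Or44.
by move=> h; exists x => //; rewrite mem_edgeP; case: h => ->; rewrite eqxx ?orbT.
Qed.

Lemma cycle_edge_flags x : x \in c -> x \in edge_flags c.
Proof. by move=> xc; apply/mem_edge_flagsP; exists x; auto using Or41. Qed.

Lemma edge_of_cycle_inj : {in c &, injective (@edge_of K)}.
Proof.
move=> x y xc yc /eqP; rewrite -mem_edgeE mem_edgeP => /or4P[]/eqP xE //.
- by have := t0_notin_cycle yc; rewrite -xE xc.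
- by have := t2_notin_cycle yc; rewrite -xE xc.
- by have := t02_notin_cycle yc; rewrite -xE xc.
Qed.

(** Two edges of the cycle meet at the vertex of [y], each with one flag of either colour there; by
    coherence [t2 (t0 x)] is the flag of the incoming edge with the colour of [y]. *)
Lemma mem_edge_flags_colour x z : x \in c -> z \in edge_flags c ->
  let y := next c x in vertex_of z = vertex_of y -> o z = o y ->
  z = y \/ z = t2 (t0 x).
Proof.
move=> xc /mem_edge_flagsP[x' x'c h] y vz oz.
have yc : y \in c by rewrite mem_next.
have t0z : vertex_of z = vertex_of (t0 x') -> x' = x.
  move=> vz'; have yE : y = next c x' by apply: next_unique; rewrite // -vz -vz'.
  by rewrite -(prev_next uc x') -yE prev_next.
case: h => zE; rewrite zE.
- by left; apply: cycle_flag_inj; rewrite // -vz zE.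
- have x'x : x' = x by apply: t0z; rewrite zE.
  by move: oz; rewrite zE x'x colour_next //; case: (o _).
- have x'y : x' = y by apply: cycle_flag_inj; rewrite // -vz zE vertex_of_t2.
  by move: oz; rewrite zE x'y flag_colour_t2; case: (o _).
- by right; rewrite t02C (t0z _) // zE t02C vertex_of_t2.
Qed.

(* Around a vertex the jumps of [chi] across the edges sum to zero, and only two
   of these edges belong to the cycle. *)
Lemma jump_next (chi : K -> int) :
  (forall z, chi (t1 z) = chi z) ->
  (forall z, z \notin edge_flags c -> chi (t2 z) = chi z) ->
  forall x, x \in c -> let y := next c x in
  chi y - chi (t2 y) = chi (t0 x) - chi (t2 (t0 x)).
Proof.
move=> chi1 chi2 x xc y; have yc : y \in c by rewrite mem_next.
pose A := [pred z | (z \in orb (@t1 K) (@t2 K) y) && (o z == o y)].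
pose y' := t2 (t0 x).
have sumA : \sum_(z in A) (chi z - chi (t2 z)) = 0.
  rewrite sumrB; apply/eqP; rewrite subr_eq0; apply/eqP.
  rewrite (sum_colour_swap (@t1K K) (@t2K K) (@t1_neq K) bK).
  rewrite [RHS](sum_colour_t (@t1K K) (@t2K K) (@t1_neq K) bK).
  by apply: eq_bigr => z _; rewrite t2K chi1.
have yA : y \in A by rewrite inE mem_orb eqxx.
have y'A : y' \in A.
  rewrite inE -vertex_ofE mem_vertexE vertex_of_t2 vertex_next // eqxx.
  by rewrite flag_colour_t2 colour_next // negbK eqxx.
have yy' : y' != y.
  by apply: contraNneq (t02_notin_cycle xc); rewrite t02C -/y' => ->.
move: sumA; rewrite (bigD1 y) //= (bigD1 y') /=; last by rewrite y'A.
rewrite big1 => [|z /andP[/andP[/andP[zv /eqP oz] zy] zy']].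
  by rewrite /y' t2K; lia.
have [/(mem_edge_flags_colour xc)|/chi2->] := boolP (z \in edge_flags c); last first.
  by rewrite subrr.
case=> //; first by apply/eqP; rewrite -mem_vertexE.
  by move/eqP; rewrite (negbTE zy).
by move/eqP; rewrite (negbTE zy').
Qed.

Lemma divides_cycle : divides_face_cycles c.
Proof.
move=> x xc; pose y := next c x; exists y, (t2 (t0 x)).
have yc : y \in c by rewrite mem_next.
have vE : vertex_of (t2 (t0 x)) = vertex_of y by rewrite vertex_of_t2 vertex_next.
have : t2 (t0 x) \in orbit (@turn K) y.
  apply: (colour_orbit (@t1K K) (@t2K K) (@t1_neq K) bK).
    by rewrite -vertex_ofE mem_vertexE vE.
  by rewrite -/o flag_colour_t2 colour_next // negbK.
rewrite /orbit -orderSpred /= inE => /orP[/eqP yE|].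
  by have := t02_notin_cycle xc; rewrite t02C yE yc.
case/splitPr=> s s'; exists s, s'; split; rewrite ?vertex_self ?edge_self //.
by rewrite mem_edgeP t02C eqxx !orbT.
Qed.

(** * Sheet numbers defined by the side of the cycle *)

Section Sheets.
Variable n : nat.

(** Indicator of the side of the cycle on which the flags of [c] lie, with values in the group of
    sheets. Including [t0 x] covers both ends of an edge; at most one of the two terms is
    nonzero. *)
Definition left_flag (x : K) : 'I_n.+2 := (x \in c)%:R + (t0 x \in c)%:R.

Lemma left_flag_t0 x : left_flag (t0 x) = left_flag x.
Proof. by rewrite /left_flag t0K addrC. Qed.

Lemma left_flag_in x : x \in c -> left_flag x = 1.
Proof. by move=> xc; rewrite /left_flag xc (negbTE (t0_notin_cycle xc)) addr0. Qed.

Lemma left_flag_t2 x : x \in c -> left_flag (t2 x) = 0.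
Proof.
move=> xc; rewrite /left_flag (negbTE (t2_notin_cycle xc)).
by rewrite (negbTE (t02_notin_cycle xc)) addr0.
Qed.

Lemma left_flag_out x : x \notin edge_flags c -> left_flag x = 0.
Proof.
move=> xc; rewrite /left_flag !(negbTE (contra (@cycle_edge_flags _) _)) ?addr0 //.
by rewrite edge_flags_t0.
Qed.

Lemma left_flag_off x : x \notin edge_flags c -> left_flag (t2 x) = left_flag x.
Proof. by move=> xc; rewrite !left_flag_out ?edge_flags_t2. Qed.

(** Where the cycle passes a vertex, coherence gives its outgoing flag and the [t0] image of the
    preceding flag opposite colours, so both colours receive the same contribution. This is
    two-sidedness in the form that a lift requires. *)
Lemma sum_left_flag x :
  \sum_(z in orb (@t1 K) (@t2 K) x | o z == true) left_flag z
  = \sum_(z in orb (@t1 K) (@t2 K) x | o z == false) left_flag z.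
Proof.
pose S b : 'I_n.+2 := \sum_(z | z \in c) ((z \in vertex_of x) && (o z == b))%:R.
suff sumE b : \sum_(z in orb (@t1 K) (@t2 K) x | o z == b) left_flag z = S b + S (~~ b).
  by rewrite !sumE addrC.
have swap (P : pred K) (Q : K -> bool) :
    \sum_(z | P z) ((Q z)%:R : 'I_n.+2) = \sum_(z | Q z) (P z)%:R.
  rewrite big_mkcond [RHS]big_mkcond /=; apply: eq_bigr => z _.
  by case: (P z) (Q z) => [] [].
rewrite big_split /=; congr (_ + _); rewrite swap //.
rewrite (reindex_inj (can_inj (@t0K K))) /=.
under eq_bigl do rewrite t0K.
rewrite /S [RHS](reindex_inj (can_inj (prev_next uc))) /=.
under [RHS]eq_bigl do rewrite mem_next.
apply: eq_bigr => z zc; rewrite -vertex_ofE !mem_vertexE vertex_next // colour_next //.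
by case: (o _) b => -[].
Qed.

Lemma exists_sheet_lift : exists rho : K -> 'I_n.+2,
  (forall x, rho (t1 x) = rho x) /\
  (forall x, rho (t2 x) - rho x = left_flag (t2 x) - left_flag x).
Proof.
exact: (orb_potential (@t1K K) (@t2K K) (@t1_neq K) bK sum_left_flag).
Qed.

End Sheets.

(** * The cut map and its two boundary cycles *)

Section CutMap.
Local Notation cutc := (cut c).
Local Notation cvertex := (@vertex_of cutc).

Lemma cut_t2_off x : x \notin edge_flags c -> @t2 cutc x = @t2 K x.
Proof. by rewrite /= /cut_t2 => /negbTE->. Qed.

Lemma cut_t2_on x : x \in edge_flags c -> @t2 cutc x = x.
Proof. by rewrite /= /cut_t2 => ->. Qed.

Lemma cut_vertexP (x : K) (P : K -> Prop) : P x ->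
  (forall z, P z -> P (t1 z)) ->
  (forall z, z \notin edge_flags c -> P z -> P (t2 z)) ->
  forall z, z \in cvertex x -> P z.
Proof.
move=> Px P1 P2; apply: (@orb_ind cutc (@t1 cutc) (@t2 cutc) x P) => // z Pz.
have [zc|zc] := boolP (z \in edge_flags c); first by rewrite cut_t2_on.
by rewrite cut_t2_off //; apply: P2.
Qed.

Lemma cut_vertex_sub (x z : K) : z \in cvertex x -> @vertex_of K z = @vertex_of K x.
Proof.
by move: z; apply: cut_vertexP => // z; rewrite ?vertex_of_t1 ?vertex_of_t2.
Qed.

(** The lift [rho] with two sheets is constant on each vertex of the cut map, but differs between
    the two sides of the cycle. *)
Lemma cut_vertex_split x : x \in c -> (@t2 K x : cutc) \notin cvertex x.
Proof.
move=> xc; have [rho [rho1 rho2]] := exists_sheet_lift 0; apply/negP => x2.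
have : rho (t2 x) = rho x.
  move: (t2 x) x2; apply: cut_vertexP => // z; first by rewrite rho1.
  move=> zc <-; apply/eqP; rewrite -subr_eq0 rho2 left_flag_off ?subrr //.
by move/eqP; rewrite -subr_eq0 rho2 left_flag_t2 // left_flag_in // sub0r.
Qed.

(** The indicator of a vertex of the cut map has equal jumps at the incoming and the outgoing edge.
    For the vertex of [next c x] the jump is 1, which forces the indicator to be 1 at [t0 x]; on the
    other side the jump is -1. *)
Lemma cut_vertex_next (x : K) : x \in c ->
  cvertex (t0 x) = cvertex (next c x) /\ cvertex (t0 (t2 x)) = cvertex (t2 (next c x)).
Proof.
move=> xc; set y := next c x; have yc : y \in c by rewrite mem_next.
pose chi (u z : K) : int := ((z : cutc) \in cvertex u).
have chi1 u z : chi u (t1 z) = chi u z.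
  by rewrite /chi !mem_vertexE (@vertex_of_t1 cutc z).
have chi2 u z : z \notin edge_flags c -> chi u (t2 z) = chi u z.
  move=> zc; rewrite /chi !mem_vertexE -(cut_t2_off zc).
  by rewrite (@vertex_of_t2 cutc z).
have jump u : chi u y - chi u (t2 y) = chi u (t0 x) - chi u (t2 (t0 x)).
  exact: (@jump_next (chi u) (chi1 u) (chi2 u) x xc).
have chi_self u : chi u u = 1 by rewrite /chi vertex_self.
have yy2 := cut_vertex_split yc.
have bound u z : (chi u z == 1) || (chi u z == 0).
  by rewrite /chi; case: (_ \in _).
split; apply/eqP; rewrite -mem_vertexE.
- have := jump y; rewrite chi_self.
  rewrite {1}/chi (negbTE yy2) => e.
  suff : chi y (t0 x) = 1 by rewrite /chi; case: (_ \in _).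
  by move: (bound y (t0 x)) (bound y (t2 (t0 x))) e; lia.
- have := jump (t2 y); rewrite chi_self.
  have -> : chi (t2 y) y = 0.
    by move: yy2; rewrite /chi !mem_vertexE eq_sym => /negbTE->.
  move=> e; rewrite t02C; suff : chi (t2 y) (t2 (t0 x)) = 1.
    by rewrite /chi; case: (_ \in _).
  by move: (bound (t2 y) (t0 x)) (bound (t2 y) (t2 (t0 x))) e; lia.
Qed.

Lemma cut_boundaries_cycle : cut_boundaries c (map (@t2 K) c : seq cutc).
Proof.
have uniq_cut (s : seq cutc) : uniq [seq @vertex_of K x | x <- s] ->
    uniq [seq cvertex x | x <- s].
  elim: s => //= x s IH /andP[xs /IH->]; rewrite andbT.
  apply: contra xs => /mapP[y ys xy]; apply/mapP; exists y => //.
  by apply: cut_vertex_sub; rewrite (@mem_vertexE cutc) xy.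
have vmap2 : [seq @vertex_of K x | x <- map (@t2 K) c] = [seq @vertex_of K x | x <- c].
  by rewrite -map_comp; apply: eq_map => x /=; rewrite vertex_of_t2.
split=> //.
- split=> [|x xc]; last by apply: cut_t2_on; apply: cycle_edge_flags.
  split=> //; first exact: uniq_cut.
  by apply: cycle_from_next => // x xc; rewrite (cut_vertex_next xc).1.
- split=> [|_ /mapP[x xc ->]]; last first.
    by apply: cut_t2_on; rewrite edge_flags_t2 cycle_edge_flags.
  split; rewrite ?size_map //; first by apply: uniq_cut; rewrite vmap2.
  rewrite cycle_map; apply: cycle_from_next => // x xc /=.
  by rewrite (cut_vertex_next xc).2.
- rewrite map_cat cat_uniq !uniq_cut ?vmap2 // andbT /=.
  apply/hasPn => _ /mapP[_ /mapP[y yc ->] ->]; apply/mapP => -[x xc yx].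
  have xy : x = y.
    apply: cycle_flag_inj => //; rewrite -[RHS](vertex_of_t2 y).
    by apply/esym/cut_vertex_sub; rewrite (@mem_vertexE cutc) yx.
  by have := cut_vertex_split yc; rewrite mem_vertexE yx xy eqxx.
- apply/setP => z; rewrite in_set.
  have zE : (@t2 cutc z == z) = (z \in edge_flags c).
    by rewrite /= /cut_t2; case: ifP => [_|_]; [exact: eqxx | exact: negbTE (bK z)].
  rewrite {}zE; apply/mem_edge_flagsP/idP.
    case=> x xc h; rewrite in_set; apply/hasP.
    have [u [uc' uz]] : exists u : cutc, u \in c ++ map (@t2 K) c /\ z \in @edge_of cutc u.
      have x2c : t2 x \in map (@t2 K) c by rewrite map_f.
      case: h => ->; [exists x | exists x | exists (t2 x) | exists (t2 x)];
        by rewrite mem_cat ?xc ?x2c ?orbT (@mem_edgeP cutc) eqxx ?orbT.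
    by exists u.
  rewrite in_set => /hasP[u]; rewrite mem_cat => uc' uz.
  have uK : u \in edge_flags c.
    case/orP: uc' => [|/mapP[x xc ->]]; first exact: cycle_edge_flags.
    exact: etrans (edge_flags_t2 c x) (cycle_edge_flags xc).
  have zu : z = u \/ z = t0 u.
    move: uz; rewrite (@mem_edgeP cutc) cut_t2_on //.
    by case/or4P=> /eqP->; auto.
  case/orP: uc' => [xc|/mapP[x xc uE]]; [exists u | exists x] => //.
    by case: zu => ->; [apply: Or41 | apply: Or42].
  by rewrite -uE; case: zu => ->; [apply: Or43 | apply: Or44].
Qed.

End CutMap.

(** * Cutting along the cycle does not separate *)

Section NonSeparating.
Hypothesis cK : connected K.
Variable h : {set K} -> bool.
Variable side : {set K} -> K.
Hypothesis sideE : forall e, e \in edges K -> side e \in e.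
(* That is, [h] is a mod 2 cocycle; an edge with both sides in [A] counts twice. *)
Hypothesis cocycle_h : forall A : {set K},
  (forall z, z \in A -> (t0 z \in A) && (t1 z \in A)) ->
  \sum_(e in edges K) (h e && ((side e \in A) (+) (t2 (side e) \in A))) = 0 :> bool.
Hypothesis h_cycle : \sum_(x <- c) h (edge_of x) = 1.

(** The parity [k] of crossing the boundary of [A] is constant along the cycle, because jumps are.
    If it were 1, the cocycle relation for [A] would reduce to the sum of [h] over the cycle, which
    is 1 and not 0. So [A] is closed across the cycle too. Both the cut map and the sheets of the
    covering are connected by this. *)
Lemma cut_closed_full (A : {set K}) : A != set0 ->
  (forall z, z \in A -> [/\ t0 z \in A, t1 z \in A & cut_t2 c z \in A]) -> A = setT.
Proof.
move=> A0 Acl.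
have A0E z : (t0 z \in A) = (z \in A).
  by apply/idP/idP => /Acl[]; rewrite ?t0K.
have A1E z : (t1 z \in A) = (z \in A).
  by apply/idP/idP => /Acl[_]; rewrite ?t1K.
have A2E z : z \notin edge_flags c -> (t2 z \in A) = (z \in A).
  move=> zc; apply/idP/idP => /Acl[_ _]; rewrite /cut_t2 ?edge_flags_t2 (negbTE zc) //.
  by rewrite t2K.
pose k z := (z \in A) (+) (t2 z \in A).
have k_next : {in c, forall x, k (next c x) = k x}.
  move=> x xc; pose chi z := (z \in A)%:Z.
  have chi1 z : chi (t1 z) = chi z by rewrite /chi A1E.
  have chi2 z : z \notin edge_flags c -> chi (t2 z) = chi z.
    by move=> zc; rewrite /chi A2E.
  have := @jump_next chi chi1 chi2 x xc; rewrite /= /chi -t02C !A0E /k.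
  by do 4!case: (_ \in A).
have [x0 x0c k0] : exists2 x0, x0 \in c & {in c, forall x, k x = k x0}.
  have : cycle (fun x y => k x == k y) c.
    by apply: cycle_from_next => // x xc; rewrite k_next.
  case: (c) size_c => // x0 c' _ /=; rewrite rcons_path => /andP[kp _].
  exists x0; rewrite ?mem_head // => x; rewrite inE => /predU1P[->//|xc'].
  have tr : transitive (fun x y => k x == k y) by move=> u v w /eqP-> /eqP->.
  by have /allP/(_ x xc')/eqP := order_path_min tr kp.
have side_c x : x \in c ->
    (side (edge_of x) \in A) (+) (t2 (side (edge_of x)) \in A) = k x0.
  move=> xc; rewrite -(k0 x xc) /k.
  have := sideE (imset_f (@edge_of K) (isT : x \in predT)).
  by rewrite mem_edgeP => /or4P[]/eqP->;
    rewrite -?t02C ?t2K ?A0E //; rewrite addbC.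
have side_out e : e \in edges K -> e \notin map (@edge_of K) c ->
    (side e \in A) (+) (t2 (side e) \in A) = false.
  move=> eK ec; rewrite A2E ?addbb //; apply: contra ec.
  case/mem_edge_flagsP=> x xc sE; apply/mapP; exists x => //.
  have : side e \in edge_of x.
    by rewrite mem_edgeP; case: sE => ->; rewrite eqxx ?orbT.
  case/imsetP: eK (sideE eK) => y _ -> ; rewrite !mem_edgeE => /eqP -> /eqP.
  by [].
have kF : k x0 = false.
  have := cocycle_h (A := A); rewrite (bigID (fun e => e \in map (@edge_of K) c)) /=.
  rewrite [X in _ + X]big1 => [|e /andP[eK ec]]; last by rewrite side_out // andbF.
  rewrite addr0 => e0.
  have : \sum_(e <- map (@edge_of K) c) (h e && k x0) = 0 :> bool.
    rewrite big_uniq /=; last by rewrite map_inj_in_uniq //; apply: edge_of_cycle_inj.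
    rewrite -[RHS]e0; last by move=> z /Acl[-> ->].
    apply: eq_big => [e|e /mapP[x xc ->]]; last by rewrite side_c.
    apply/idP/andP => [/mapP[x xc ->]|[]//].
    by rewrite imset_f // map_f.
  rewrite big_map; case: (k x0) => //.
  by under eq_bigr do rewrite andbT; rewrite h_cycle.
apply: (connected_closed cK A0) => z zA; rewrite A0E A1E zA; split=> //.
have [zc|zc] := boolP (z \in edge_flags c); last by rewrite A2E.
case/mem_edge_flagsP: zc zA => x xc; have := k0 x xc; rewrite kF /k.
by move=> kx; case=> ->; rewrite -?t02C ?t2K ?A0E; move: kx; do 2!case: (_ \in A).
Qed.
End NonSeparating.
End Cycle.

(** * Cocycles and the graph of a map *)

(** Linear algebra over the field [bool]: the kernel of [D1] has dimension at least [#|E| - #|F|],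
    too large for the span of the [#|V|] rows of [D0] and of [W]. *)
Lemma exists_cocycle (E F V : finType) (d1 : E -> F -> bool) (d0 : V -> E -> bool)
    (w : E -> bool) : (#|F| + (#|V| + 1) < #|E|)%N ->
  exists h : E -> bool, (forall f, \sum_e h e * d1 e f = 0) /\
    forall phi k, exists e, h e != (\sum_v phi v * d0 v e) + k * w e.
Proof.
move=> card_lt.
pose D1 : 'M[bool]_(#|E|, #|F|) := \matrix_(i, j) d1 (enum_val i) (enum_val j).
pose D0 : 'M[bool]_(#|V|, #|E|) := \matrix_(i, j) d0 (enum_val i) (enum_val j).
pose W : 'rV[bool]_#|E| := \row_j w (enum_val j).
have : ~~ (kermx D1 <= col_mx D0 W)%MS.
  apply/negP => /mxrankS; rewrite mxrank_ker.
  have := rank_leq_col D1; have := rank_leq_row (col_mx D0 W); lia.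
case/row_subPn=> i; set u := row i _ => uB.
have uD : u *m D1 = 0 by apply/sub_kermxP; apply: row_sub.
exists (fun e => u 0 (enum_rank e)); split=> [f|phi k].
  have := congr1 (fun M : 'rV_#|F| => M 0 (enum_rank f)) uD.
  rewrite !mxE => uf; rewrite -[RHS]uf [RHS](reindex enum_rank) /=;
    last exact/onW_bij/enum_rank_bij.
  by apply: eq_bigr => e _; congr (_ * _); rewrite mxE !enum_rankK.
apply/existsP/contraT; rewrite negb_exists => /forallP hE; case/negP: uB; apply/submxP.
exists (row_mx (\row_j phi (enum_val j)) (const_mx k)); apply/rowP => j.
rewrite mul_row_col [RHS]mxE [X in _ = X + _]mxE [X in _ = _ + X]mxE.
rewrite big_ord1 [const_mx _ _ _]mxE [W _ _]mxE.
have := hE (enum_val j); rewrite negbK enum_valK => /eqP ->; congr (_ + _).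
rewrite [RHS](reindex enum_rank) /=; last exact/onW_bij/enum_rank_bij.
by apply: eq_bigr => v _; rewrite !mxE !enum_rankK.
Qed.

Section Graph.
Variable K : cmap.
Hypotheses (bK : boundaryless K) (cK : connected K) (polyK : polyhedral K).
Hypothesis face3 : forall f, f \in faces K -> (2 < face_length f)%N.
Local Notation o := (@flag_colour K).

Definition graph_vertex := {v : {set K} | v \in vertices K}.
Local Notation V := graph_vertex.

Definition vtx (x : K) : V :=
  Sub (vertex_of x) (imset_f (@vertex_of K) (isT : x \in predT)).

Definition adjacent : rel V :=
  [rel u v | [exists x, (vtx x == u) && (vtx (t0 x) == v)]].

Lemma vtxP x y : reflect (vertex_of x = vertex_of y) (vtx x == vtx y).
Proof. by rewrite -val_eqE /=; apply: eqP. Qed.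

Lemma vtx_eq x y : vertex_of x = vertex_of y -> vtx x = vtx y.
Proof. by move/vtxP/eqP. Qed.

Lemma vtx_surj (u : V) : exists x, u = vtx x.
Proof.
case: u => A AV; case/imsetP: (AV) => x _ AE; exists x.
by apply: val_inj; rewrite /= AE.
Qed.

Lemma adjacent_t0 x : adjacent (vtx x) (vtx (t0 x)).
Proof. by apply/existsP; exists x; rewrite !eqxx. Qed.

Lemma adjacentP u v : reflect (exists x, u = vtx x /\ v = vtx (t0 x)) (adjacent u v).
Proof.
apply: (iffP existsP) => [[x /andP[/eqP<- /eqP<-]]|[x [-> ->]]]; first by exists x.
by exists x; rewrite !eqxx.
Qed.

Lemma adjacentC : symmetric adjacent.
Proof.
move=> u v; apply/adjacentP/adjacentP => -[x [-> ->]]; exists (t0 x);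
  by rewrite t0K.
Qed.

Lemma adjacent_irr : irreflexive adjacent.
Proof.
move=> u; apply/adjacentP => -[x [-> /eqP/vtxP v0]].
by have := ends_neq polyK face3 x; rewrite -v0 eqxx.
Qed.

Lemma adjacent_connected (S : {set V}) : S != set0 -> S != setT ->
  exists u v, [/\ u \in S, v \notin S & adjacent u v].
Proof.
move=> S0 ST; apply: NNPP => no_uv; case/eqP: ST; apply/setP => v; rewrite in_setT.
have [y ->] := vtx_surj v.
have : y \in [set x | vtx x \in S]; last by rewrite in_set.
rewrite (connected_closed cK (S := [set x | vtx x \in S])) ?in_setT //.
  have /set0Pn[u] := S0; have [x ->] := vtx_surj u => xS.
  by apply/set0Pn; exists x; rewrite in_set.
move=> x; rewrite !in_set => xS; split.
- apply/negPn/negP => x0S; apply: no_uv; exists (vtx x), (vtx (t0 x)).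
  by split=> //; apply: adjacent_t0.
- by rewrite (vtx_eq (vertex_of_t1 x)).
- by rewrite (vtx_eq (vertex_of_t2 x)).
Qed.

(* An ear is cut out of the boundary of a face having two consecutive edges at a
   vertex of [S] of which only one leaves [S]. *)
Lemma adjacent_ears : has_ears adjacent.
Proof.
move=> S S0 ST nbr.
have [u [v [xS x0S /adjacentP[x [uE vE]]]]] := adjacent_connected S0 ST.
rewrite {}uE {}vE {u v} in xS x0S.
(* If no corner at the vertex of [x] had one edge leaving [S] and one staying, then, turning about
   the vertex, every edge there would leave [S], against [nbr]. *)
have [z /and3P[zS z0S z1S]] : exists z : K,
    [&& vtx z \in S, vtx (t0 z) \notin S & vtx (t0 (t1 z)) \in S].
  apply/existsP/contraT; rewrite negb_exists => /forallP no_z.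
  have [v vS /adjacentP[y [yE vE]]] := nbr _ xS.
  have : vtx y = vtx x /\ vtx (t0 y) \notin S.
    have : y \in vertex_of x by rewrite mem_vertexE; apply/eqP/vtxP/eqP.
    apply: (@orb_ind K (@t1 K) (@t2 K) x
      (fun y => vtx y = vtx x /\ vtx (t0 y) \notin S)) => // w [wE w0].
    - rewrite (vtx_eq (vertex_of_t1 w)) wE; split=> //.
      by have := no_z w; rewrite wE xS w0.
    - rewrite (vtx_eq (vertex_of_t2 w)) wE; split=> //.
      by rewrite t02C (vtx_eq (vertex_of_t2 _)).
  by case=> _; rewrite -vE vS.
(* The walk around the face of [z]: it leaves [S] at once, and its last vertex, the other neighbour
   of the start, is in [S] again. The ear ends at the first return. *)
pose st := @t1 K \o @t0 K; pose zs i := iter i st z; pose vt i := vtx (zs i).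
have st_inj : injective st := dihedral_rot_inj (@t0K K) (@t1K K).
pose n := order st z.
have vt_st i : vt i.+1 = vtx (t0 (zs i)) by rewrite /vt /= (vtx_eq (vertex_of_t1 _)).
have face_zs i : face_of (zs i) = face_of z.
  by elim: i => //= i IH; rewrite face_of_t1 face_of_t0.
have zs_t1 i j : (i <= j)%N -> zs j != t1 (zs i).
  move=> ij; rewrite /zs -(subnK ij) iterD.
  exact: iter_rot_neq_t (@t0K K) (@t1K K) (@t0_neq K) (@t1_neq K) _ _.
have vt_inj i j : (i < n)%N -> (j < n)%N -> vt i = vt j -> i = j.
  move=> ltin ltjn /eqP/vtxP vij.
  have [zij|zij] := face_vertex_inj polyK vij (etrans (face_zs i) (esym (face_zs j))).
    by rewrite -(findex_iter ltin) -(findex_iter ltjn); congr findex.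
  have [ij|/ltnW ji] := leqP i j.
    by have := zs_t1 _ _ ij; rewrite zij t1K eqxx.
  by have := zs_t1 _ _ ji; rewrite zij eqxx.
have n0 : (0 < n)%N := order_gt0 st z.
have lastS : vt n.-1 \in S.
  have : st (zs n.-1) = z by rewrite /zs -iterS prednK // iter_order.
  move=> /(congr1 (@t1 K)); rewrite /st /= t1K => zn.
  have : vtx (t0 (t0 (zs n.-1))) \in S by rewrite zn.
  by rewrite t0K.
have n1 : (0 < n.-1)%N.
  rewrite lt0n; apply: contraNneq z0S => n1.
  have : st (zs n.-1) = z by rewrite /zs -iterS prednK // iter_order.
  by rewrite n1 /st /= => /(congr1 vtx); rewrite (vtx_eq (vertex_of_t1 _)) => ->.
have ex_j : exists j, (0 < j)%N && (vt j \in S) by exists n.-1; rewrite n1.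
case: (ex_minnP ex_j) => j /andP[j0 jS] jmin.
have j1 : (1 < j)%N.
  by rewrite ltn_neqAle j0 andbT; apply: contraTneq jS => <-; rewrite vt_st.
have jn : (j < n)%N by rewrite -(prednK n0) ltnS; apply: jmin; rewrite n1.
have vt_path k m : path adjacent (vt m) [seq vt i | i <- iota m.+1 k].
  elim: k m => //= k IH m; rewrite IH andbT vt_st; exact: adjacent_t0.
exists (vt 0), [seq vt i | i <- iota 1 j.-1], (vt j); split.
  by apply/eqP => /(vt_inj _ _ n0 jn) j0'; rewrite -j0' in j0.
have iotaE : rcons (iota 1 j.-1) j = iota 1 j.
  by have := iotaD 1 j.-1 1; rewrite addn1 prednK // => ->; rewrite /= add1n prednK // cats1.
split=> //.
- by rewrite -map_rcons iotaE vt_path.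
- rewrite map_inj_in_uniq ?iota_uniq // => a b; rewrite !mem_iota => ha hb.
  by apply: vt_inj; lia.
- by rewrite -size_eq0 size_map size_iota; lia.
- move=> _ /mapP[i + ->]; rewrite mem_iota => hi; apply/negP => iS.
  by have := jmin i; rewrite iS; lia.
Qed.

Section FlagFunction.
Variable g : K -> bool.
Hypotheses (g0 : forall x, g (t0 x) = g x) (g2 : forall x, g (t2 x) = g x).

(** The choice of the flag does not matter, as adjacent vertices of a polyhedral map are joined by a
    single edge. *)
Definition edge_value (u v : V) : bool :=
  if [pick x | (vtx x == u) && (vtx (t0 x) == v)] is Some x then g x else false.

Lemma edge_valueE x : edge_value (vtx x) (vtx (t0 x)) = g x.
Proof.
rewrite /edge_value; case: pickP => [y /andP[/vtxP y1 /vtxP y2]|]; last first.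
  by move/(_ x); rewrite !eqxx.
have := no_multi_edge polyK face3 y1 y2; rewrite mem_edgeP.
by case/or4P=> /eqP->; rewrite ?g0 ?g2.
Qed.

Lemma edge_valueC u v : edge_value u v = edge_value v u.
Proof.
rewrite {1}/edge_value; case: pickP => [x /andP[/eqP<- /eqP<-]|no_x].
  by have := edge_valueE (t0 x); rewrite t0K g0 => ->.
rewrite /edge_value; case: pickP => // x /andP[x1 x2].
by have := no_x (t0 x); rewrite t0K x1 x2.
Qed.

End FlagFunction.

(** The cochain [w]: flags exchanged by [t0] have opposite colours when the local orientations at
    the two ends agree, so equal colours mark an orientation-reversing edge. *)
Definition twist (x : K) : bool := o x == o (t0 x).

Lemma twist_t0 x : twist (t0 x) = twist x.
Proof. by rewrite /twist t0K eq_sym. Qed.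

Lemma twist_t2 x : twist (t2 x) = twist x.
Proof.
by rewrite /twist t02C !flag_colour_t2 //; case: (o x) (o (t0 x)) => [] [].
Qed.

Lemma flag_of_colour u v s : adjacent u v ->
  exists x, [/\ vtx x = u, vtx (t0 x) = v & o x = s].
Proof.
case/adjacentP=> x [-> ->]; have [xs|xs] := eqVneq (o x) s; first by exists x.
exists (t2 x); split; first exact/vtx_eq/vertex_of_t2.
  by rewrite t02C; apply/vtx_eq/vertex_of_t2.
by rewrite flag_colour_t2 //; case: (o x) s xs => [] [].
Qed.

(** Of the two sides of each edge, the one is taken whose colour continues the preceding flag. The
    colour reached at the end records the [w]-gain, so a closed path closes coherently exactly when
    this gain is zero. *)
Lemma coherent_lift (g : K -> bool) : (forall x, g (t0 x) = g x) ->
  (forall x, g (t2 x) = g x) ->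
  forall q v y s, path adjacent v (y :: q) -> exists x d,
  [/\ map vtx (x :: d) = belast v (y :: q), o x = s, path (@coherent K) x d,
      vtx (t0 (last x d)) = last y q /\
      o (t0 (last x d)) = s (+) ~~ gain (edge_value twist) v (y :: q)
    & \sum_(z <- x :: d) g z = gain (edge_value g) v (y :: q)].
Proof.
move=> g0 g2; elim=> [|y' q IH] v y s /=.
  rewrite andbT => /(flag_of_colour s)[x [<- <- xs]]; exists x, [::]; split=> //.
    split=> //; rewrite edge_valueE; [|exact: twist_t0|exact: twist_t2].
    by rewrite /twist -xs /=; case: (o x) (o (t0 x)) => [] [].
  by rewrite big_seq1 edge_valueE //= addbF.
case/andP=> /(flag_of_colour s)[x [xv xy xs]] pq.
have [x' [d [dE x's px [lv lo] sg]]] := IH y y' (s (+) edge_value twist v y) pq.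
exists x, (x' :: d); split=> //.
- by rewrite /= xv; congr (_ :: _).
- rewrite /= px andbT; apply/andP; split.
    by apply/eqP/vtxP/eqP; rewrite xy; case: dE.
  rewrite x's -xv -xy edge_valueE; [|exact: twist_t0|exact: twist_t2].
  by rewrite /twist -xs; case: (o x) (o (t0 x)) => [] [].
- split=> //=; rewrite lo /=.
  by case: s (edge_value _ v y) (edge_value _ y y') (gain _ y' q) {xs lo x's} => [] [] [] [].
- by rewrite big_cons sg -xv -xy edge_valueE.
Qed.

End Graph.

(** * The surgery cycle *)

Lemma semi_equivelar_face3 X K : semi_equivelar X K ->
  forall F, F \in faces K -> (2 < face_length F)%N.
Proof.
case=> bK _ _ /and3P[_ wfX _] typeX _ /imsetP[y _ ->].
have [x xy xE] := typeX _ (imset_f (@vertex_of K) (isT : y \in predT)).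
have yx : y \in vertex_of x.
  by move: xy; rewrite !mem_vertexE eq_sym.
have : face_length (face_of y) \in type_word X.
  rewrite -xE map_f //; have /orP[yo|yo] := orb_rot (@t1K K) (@t2K K) yx.
    exact: map_f.
  by rewrite -face_of_t1; apply: map_f.
case/flattenP=> _ /mapP[a aX ->]; rewrite mem_nseq => /andP[_ /eqP->].
by case/andP: (allP wfX a aX).
Qed.

Section CocycleOfMap.
Variables (K : cmap) (x0 : K).

Definition side (e : {set K}) : K := odflt x0 [pick x in e].

Lemma sideE e : e \in edges K -> side e \in e.
Proof.
case/imsetP=> x _ ->; rewrite /side; case: pickP => //= /(_ x).
by rewrite edge_self.
Qed.

Definition edge_type := {e : {set K} | e \in edges K}.
Definition face_type := {f : {set K} | f \in faces K}.

(** [A] is a disjoint union of faces, and its relation is the sum of the relations of these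
    faces. *)
Lemma face_cocycle (h : {set K} -> bool) :
  (forall f : face_type, \sum_(e : edge_type) h (val e) *
     ((side (val e) \in val f) + (t2 (side (val e)) \in val f)) = 0) ->
  forall A : {set K}, (forall z, z \in A -> (t0 z \in A) && (t1 z \in A)) ->
  \sum_(e in edges K) (h e && ((side e \in A) (+) (t2 (side e) \in A))) = 0 :> bool.
Proof.
move=> hf A Acl.
have face_sub z : z \in A -> face_of z \subset A.
  move=> zA; apply/subsetP; apply: orb_ind => // y /Acl/andP[] //.
have memA z : (z \in A) = \sum_(f : face_type | val f \subset A) (z \in val f) :> bool.
  pose fz : face_type := Sub (face_of z) (imset_f (@face_of K) (isT : z \in predT)).
  have fzE (f : face_type) : z \in val f -> f = fz.
    move=> zf; apply: val_inj; rewrite /=; case: f zf => F FK /=.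
    by case/imsetP: FK => y _ ->; rewrite mem_faceE => /eqP.
  have [zA|zA] := boolP (z \in A).
    rewrite (bigD1 fz) /=; last exact: face_sub.
    rewrite face_self big1 // => f /andP[_ ffz]; apply/negbTE; apply: contraNN ffz.
    by move/fzE->.
  rewrite big1 // => f fA; apply/negbTE; apply: contraNN zA; exact: (subsetP fA).
transitivity (\sum_(f : face_type | val f \subset A) \sum_(e : edge_type) h (val e) *
     ((side (val e) \in val f) + (t2 (side (val e)) \in val f))).
  rewrite exchange_big big_sub /=; apply: eq_bigr => e _.
  rewrite -mulr_sumr big_split /=.
  by rewrite -!memA.
by rewrite big1.
Qed.

End CocycleOfMap.

Lemma exists_surgery_cycle X K : semi_equivelar X K -> euler K = - 2%:Z ->
  exists (c : seq K) (h : {set K} -> bool) (s : {set K} -> K),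
  [/\ uniq [seq vertex_of x | x <- c] /\ (2 < size c)%N,
      cycle (@coherent K) c,
      forall e, e \in edges K -> s e \in e,
      forall A : {set K}, (forall z, z \in A -> (t0 z \in A) && (t1 z \in A)) ->
        \sum_(e in edges K) (h e && ((s e \in A) (+) (t2 (s e) \in A))) = 0 :> bool
    & \sum_(x <- c) h (edge_of x) = 1].
Proof.
move=> eqK; have face3 := semi_equivelar_face3 eqK.
case: eqK => bK cK polyK _ _ eulerK.
have [[x0 _] _] := (connectedP K).1 cK.
pose V := graph_vertex K; pose E := edge_type K; pose F := face_type K.
have card_lt : (#|{: F}| + (#|{: V}| + 1) < #|{: E}|)%N.
  have cV : #|{: V}| = #|vertices K| by rewrite card_sig; apply: eq_card.
  have cE : #|{: E}| = #|edges K| by rewrite card_sig; apply: eq_card.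
  have cF : #|{: F}| = #|faces K| by rewrite card_sig; apply: eq_card.
  by rewrite cV cE cF; move: eulerK; rewrite /euler; lia.
(* Mod 2 incidence numbers, computed from one flag of each edge. *)
pose d1 (e : E) (f : F) : bool :=
  ((side x0 (val e) \in val f) : bool) + (t2 (side x0 (val e)) \in val f).
pose d0 (v : V) (e : E) : bool :=
  ((v == vtx (side x0 (val e))) : bool) + (v == vtx (t0 (side x0 (val e)))).
have [h' [h'f h'0]] :=
  @exists_cocycle E F V d1 d0 (fun e => twist (side x0 (val e))) card_lt.
pose h (e : {set K}) := oapp h' false (insub e).
have hE (e : E) : h (val e) = h' e by rewrite /h valK.
pose g x := h (edge_of x).
have g0 x : g (t0 x) = g x by rewrite /g edge_of_t0.
have g2 x : g (t2 x) = g x by rewrite /g edge_of_t2.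
have tw0 := @twist_t0 K; have tw2 := twist_t2 bK.
have [|v [q [[pq uq sq] gw gh]]] := exists_simple_cycle (@adjacentC K)
  (adjacent_irr polyK face3) (adjacent_ears cK polyK) (adjacent_connected cK)
  (edge_valueC polyK face3 tw0 tw2) (edge_valueC polyK face3 g0 g2).
  move=> phi k; have [e he] := h'0 phi k; set x := side x0 (val e) in he *.
  have xe : edge_of x = val e.
    have := sideE x0 (valP e); rewrite -/x; case/imsetP: (valP e) => y _ ->.
    by rewrite mem_edgeE => /eqP.
  exists (vtx x), (vtx (t0 x)); split; first exact: adjacent_t0.
  rewrite !edge_valueE // /g xe hE; apply: contraNneq he => ->; apply/eqP.
  have pick1 (a : V) : \sum_w phi w * (w == a) = phi a :> bool.
    rewrite (bigD1 a) //= big1 => [|w /negbTE->]; last by rewrite mulr0.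
    by rewrite eqxx addr0; case: (phi a).
  rewrite /d0; under eq_bigr do rewrite mulrDr.
  by rewrite big_split /= !pick1.
have [y [p pE]] : exists y p, rcons q v = y :: p.
  by case: (q) => [|y p]; [exists v, [::] | exists y, (rcons p v)].
rewrite pE in pq.
(* The starting colour [false] is arbitrary; the chain closes coherently because the [w]-gain is
   zero. *)
have [x [d [dE xs px [lv lo] sg]]] := coherent_lift bK polyK face3 g0 g2 false pq.
have cE : map (@vtx K) (x :: d) = v :: q by rewrite dE -pE belast_rcons.
have sd : size (x :: d) = (size q).+1 by rewrite -(size_map (@vtx K)) cE.
exists (x :: d), h, (side x0); split.
- split; last by rewrite sd.
  have -> : [seq vertex_of z | z <- x :: d] = map val (map (@vtx K) (x :: d)).
    by rewrite -map_comp; apply: eq_map.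
  by rewrite cE map_inj_uniq //; apply: val_inj.
- rewrite /= rcons_path px /=; apply/andP; split.
    apply/eqP/vtxP/eqP; rewrite lv.
    have -> : last y p = v by rewrite -[last y p]/(last v (y :: p)) -pE last_rcons.
    by case: cE.
  by rewrite lo -pE gw xs.
- exact: sideE.
- apply: face_cocycle => f; rewrite -[RHS](h'f f).
  by apply: eq_bigr => e _; rewrite hE.
- by rewrite sg -pE gh.
Qed.

Theorem theorem1p1 (X : map_type) (K : cmap) (hK : semi_equivelar X K)
    (hchi : euler K = - 2%:Z) (m : nat) (hm : (2 <= m)%N) :
  exists Km : cmap,
    [/\ semi_equivelar X Km, covering_map m K Km & euler Km = - (2 * m)%N%:Z].
Proof.
have [c [h [s [[uniq_c size_c] coh_c sE cocycle_h h_cycle]]]] :=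
  exists_surgery_cycle hK hchi.
have face3 := semi_equivelar_face3 hK.
have [bK cK polyK _ _] := hK.
case: m hm => [|[|n]] // _.
have full := cut_closed_full bK uniq_c size_c coh_c cK sE cocycle_h h_cycle.
have [rho [rho1 rho2]] := exists_sheet_lift bK uniq_c coh_c n.
have [y yc] : exists y, y \in c by case: (c) size_c => // y c' _; exists y; apply: mem_head.
have on := left_flag_in uniq_c coh_c n.
have off2 := left_flag_t2 bK uniq_c size_c coh_c n.
exists (sheet_cover (left_flag_t0 c n)); split.
- apply: (semi_equivelar_cover _ rho1 rho2) => //.
    move=> S S0 Scl; apply: full => // z zS; have [z0 z1 z2] := Scl z zS; split=> //.
    by rewrite /cut_t2; case: ifP => // /negbT zc; apply: z2; apply: left_flag_off.
  by exists (t2 y); rewrite t2K on // off2 // add0r.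
- have cut_conn : connected (cut c).
    by apply: (@closed_connected (cut c) y) => S S0 Scl; apply: full.
  exists c; split.
  + split=> //; apply: cycle_from_next; first exact: map_uniq uniq_c.
    by move=> x xc; rewrite (vertex_next coh_c).
  (* The cut map has a single component, which contains both sides of the cycle; it can be neither a
     disk on one side nor one of several pieces. *)
  + split=> [[D] DK [/(_ y yc)] + _|[_]]; last by rewrite /separates cut_conn.
    have [_ cc] := (connectedP (cut c)).1 cut_conn.
    by case/imsetP: DK => x _ ->; rewrite !in_set !cc.
  + exact: divides_cycle.
  exists c, (map (@t2 K) c); split; first exact: cut_boundaries_cycle.
  (* The cut map has the flags of [K], so the copies of the cut map are the sheets themselves. *)
  exists id; split=> //; first by exists id.
  + move=> x i x2; have xc : x \notin edge_flags c.
      by apply: contraNN x2 => xc; rewrite cut_t2_on.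
    rewrite cut_t2_off //; congr (_, _).
    by rewrite /= left_flag_off // subrr addr0.
  + have zE : zip (map (@t2 K) c) c = [seq (t2 w, w) | w <- c].
      by rewrite -{2}[c]map_id zip_map.
    move=> x z i xz; have : (x, z) \in zip (map (@t2 K) c) c := xz.
    rewrite zE => /mapP[w wc [-> ->]].
    (* Crossing from the second boundary to the first changes the indicator from 0 to 1, so the
       sheet goes up by one, as [ordS] does. *)
    congr (_, _); first exact: t2K.
    by rewrite /= t2K on // off2 // subr0; apply: (@add_Zp_1 n.+2 i).
by rewrite (euler_cover _ rho1 rho2) hchi; lia.
Qed.
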